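(* Let $g(x)=\alpha x^{q^k}+\beta x$ with $\alpha\in\mathbb{F}_{q^n}^*$, $\beta\in\mathbb{F}_{q^n}$, $1\le k<n$, and let $f(y)=\sum_{i=0}^d a_iy^{q^i}\in\mathbb{F}_{q^n}[y]$, $0\le d<n$, $a_d\ne0$, be not a monomial. Let $0\le h\le\ell$. Define \[m_h=\begin{cases}\ell_2 & \text{if } \beta a_h=1,\\ h & \text{if } \beta\ne0 \text{ and } \beta a_h\ne1,\\ d & \text{if } \beta=0.\end{cases}\] If $k+d-\min\{m_h,\ell\}+1\le n/2$, then $L_g\cap\sigma(L_f)\ne\emptyset$.
   Context: Let $q$ be a prime power, $n\ge2$. For $f(y)=\sum_{i=0}^d a_iy^{q^i}$ with $a_d\neq0$: $\ell=\min\{i: a_i\ne0\}$; when $f$ is not a monomial (i.e. has at least two nonzero coefficients), $\ell_2=\min\{i>\ell: a_i\ne0\}$ and $\ell_3=\max\{i<d:a_i\ne0\}$. Coefficients $a_i$ with $i$ outside the support are $0$. For an integer $0\le h<n$: $L_g=\{\langle(x,g(x))\rangle_{\mathbb{F}_{q^n}}:x\in\mathbb{F}_{q^n}^*\}$ and $\sigma(L_f)=\{\langle(f(y),y^{q^h})\rangle_{\mathbb{F}_{q^n}}:y\in\mathbb{F}_{q^n}^*\}$, points of $\mathrm{PG}(1,q^n)$. *)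

(* Defs.v *)
From HB Require Import structures.
From mathcomp Require Import all_boot all_order all_algebra all_field.
Set Implicit Arguments. Unset Strict Implicit. Unset Printing Implicit Defensive.
Import GRing.Theory.
Local Open Scope ring_scope.

Definition prime_power (q : nat) : Prop :=
  exists p e : nat, prime p /\ (0 < e)%N /\ q = (p ^ e)%N.

Definition linq_f (F : fieldType) (q d : nat) (a : nat -> F) (y : F) : F :=
  \sum_(i < d.+1) a i * y ^+ (q ^ i).

Definition gbin (F : fieldType) (q k : nat) (alpha beta : F) (x : F) : F :=
  alpha * x ^+ (q ^ k) + beta * x.

Definition ell (F : fieldType) (d : nat) (a : nat -> F) : nat :=
  find (fun i => a i != 0) (iota 0 d.+1).

Definition ell2 (F : fieldType) (d : nat) (a : nat -> F) : nat :=
  find (fun i => (ell d a < i)%N && (a i != 0)) (iota 0 d.+1).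

Definition m_h (F : fieldType) (d h : nat) (a : nat -> F) (beta : F) : nat :=
  if beta == 0 then d
  else if beta * a h == 1 then ell2 d a else h.

(* two nonzero vectors of F^2 span the same point of PG(1, F) *)
Definition same_point (F : fieldType) (u v : F * F) : Prop :=
  exists lam : F, lam != 0 /\ u.1 = lam * v.1 /\ u.2 = lam * v.2.

Definition Lg_meets_sigmaLf (F : fieldType) (g f : F -> F) (q h : nat) : Prop :=
  exists x y : F, x != 0 /\ y != 0 /\
    same_point (x, g x) (f y, y ^+ (q ^ h)).

(* Main.v *)
(** For y with A(y) = y^(q^h) - beta f(y) and B(y) = alpha f(y) both nonzero, the
    equation to solve is x^(q^k - 1) = A(y) / B(y), so a suitable y exists as soon as
    A(y) / B(y) is an m-th power, m = gcd(q^k - 1, q^n - 1).  Summing the characters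
    of order dividing m, this follows from Weil's bound for the sums of
    chi(A(y) / B(y)).  A and B have the same roots as polynomials of degree at most
    q^(d - j), j = min(m_h, l), so at most 2 q^(d - j) points of the line are
    ramified, and f has a nonzero root of multiplicity q^l, prime to m, which is not
    a root of A, so A / B is not a power.

    Weil's bound is proved as follows.  Over the algebraic closure K of F, let
    X(g) = chi(Res(A, g) / Res(B, g)).  The sums e_k of X over the monic polynomials
    of degree k vanish once k reaches the number of ramified points, and unique
    factorization gives Newton's identities between the e_k and the character sums
    S_i over the extensions of degree i, so that S_i = - sum_j w_j^i for the
    reciprocal roots w_j of sum_k e_k T^k.  Stepanov's method gives
    S_2i = O(|F|^i), whence |w_j|^2 <= |F|. *)
Require Import Defs.
From HB Require Import structures.
From mathcomp Require Import all_boot all_order all_algebra all_solvable all_field.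
From mathcomp Require Import zify ring.
Set Implicit Arguments. Unset Strict Implicit. Unset Printing Implicit Defensive.
Import Order.TTheory GRing.Theory Num.Theory.
Local Open Scope ring_scope.

(** * Stepanov's method *)

(** There are more polynomials than the dimension of the space containing them, so the matrix of
    their coefficients has a nonzero left kernel. *)
Lemma poly_family_dependent (K : fieldType) (I : finType) (q : I -> {poly K}) T :
  (forall i, size (q i) <= T)%N -> (T < #|I|)%N ->
  exists2 v : I -> K, exists i, v i != 0 & \sum_i v i *: q i = 0.
Proof.
move=> sz_q ltT.
pose A : 'M[K]_(#|I|, T) := \matrix_(i < #|I|) poly_rV (q (enum_val i)).
have kerN0 : kermx A != 0.
  rewrite kermx_eq0 /row_free; apply/negP => /eqP rA.
  by have := rank_leq_col A; rewrite rA leqNgt ltT.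
have [[r s] nz_rs] : exists ij, kermx A ij.1 ij.2 != 0.
  apply/existsP; apply: contraNT kerN0 => /existsPn k0; apply/eqP/matrixP => i j.
  by rewrite [RHS]mxE; apply/eqP; have := k0 (i, j); rewrite negbK.
exists (fun i => kermx A r (enum_rank i)).
  by exists (enum_val s); rewrite enum_valK.
have /(congr1 (fun B => row r B)) := mulmx_ker A.
rewrite row_mul row0 mulmx_sum_row => E0.
have : rVpoly (\sum_i (row r (kermx A)) 0 i *: row i A) = 0 by rewrite E0 linear0.
rewrite linear_sum /= => E1; rewrite -[RHS]E1 [RHS](reindex (@enum_rank I)) /=; last first.
  by exists enum_val => x _; rewrite ?enum_rankK ?enum_valK.
by apply: eq_bigr => i _; rewrite linearZ /= rowK [row r _ 0 _]mxE poly_rV_K ?enum_rankK.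
Qed.

(** Among the indices with [v i != 0], the one with the least [N i] is alone in contributing to the
    coefficient of degree [N i]. *)
Lemma distinct_valuations_free (K : fieldType) (I : finType) (N : I -> nat)
    (h : I -> {poly K}) (v : I -> K) :
  injective N -> (forall i, (h i)`_0 != 0) ->
  \sum_i v i *: ('X^(N i) * h i) = 0 -> forall i, v i = 0.
Proof.
move=> injN h0 sum0 i1; apply/eqP/negPn/negP => nz1.
case: (arg_minnP N (P := fun i => v i != 0) nz1) => i nzi mini.
have /(congr1 (fun p : {poly K} => p`_(N i))) := sum0.
rewrite coef_sum coef0 (bigD1 i) //= big1 ?addr0 => [|j ji].
  by rewrite coefZ coefXnM ltnn subnn; apply/eqP; rewrite mulf_neq0.
have [->|/mini leij] := eqVneq (v j) 0; first by rewrite scale0r coef0.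
rewrite coefZ coefXnM ifT ?mulr0 // ltn_neqAle leij andbT.
by apply: contraNneq ji => /injN ->.
Qed.

(** The exponents are the valuations at 0 of the p_i in [stepanov]. Writing mu (m-1-j) = z m + r and
    M = m n0 + 1, the exponent plus mu equals M (b + z) + r n0 + (c + mu - z) with c + mu - z < n0.
    Division by M, then by n0, recovers b + z and r, and r determines j because mu is invertible
    modulo m. *)
Lemma stepanov_exponent_inj m mu n0 a bn :
  coprime m mu -> (a + mu <= n0)%N ->
  injective (fun i : 'I_m * 'I_bn * 'I_a =>
    (mu * (m.-1 - i.1.1) * n0 + (i.2 + (m * n0).+1 * i.1.2))%N).
Proof.
move=> co le_a [[j b] c] [[j' b'] c'] /=.
have H (i : 'I_m) : exists z r : nat, [/\ mu * (m.-1 - i) = z * m + r, z <= mu & r < m]%N.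
  exists (mu * (m.-1 - i) %/ m)%N, (mu * (m.-1 - i) %% m)%N.
  have m_gt0 : (0 < m)%N by case: (i) => ? /=; case: (m).
  rewrite -divn_eq ltn_mod m_gt0; split=> //.
  rewrite -{2}(mulnK mu m_gt0) leq_div2r // leq_mul2l; lia.
have [z [r [E lez ltr]]] := H j; have [z' [r' [E' lez' ltr']]] := H j'.
rewrite E E' => Eq.
have ltc := ltn_ord c; have ltc' := ltn_ord c'.
set M := (m * n0).+1 in Eq.
have key : ((r * n0 + (c + (mu - z))) + M * (b + z) = (r' * n0 + (c' + (mu - z'))) + M * (b' + z'))%N.
  move: Eq; rewrite /M => Eq; lia.
have small (s : nat) (x : nat) : (s < m -> x < n0 -> s * n0 + x < M)%N.
    move=> lt_sm lt_x; have : (s.+1 * n0 <= m * n0)%N by rewrite leq_mul2r lt_sm orbT.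
    by rewrite /M mulSn; lia.
have s1 : (r * n0 + (c + (mu - z)) < M)%N by apply: small => //; lia.
have s2 : (r' * n0 + (c' + (mu - z')) < M)%N by apply: small => //; lia.
have eb : (b + z = b' + z')%N.
  have := congr1 (divn^~ M) key.
  by rewrite !(mulnC M) !divnDMl // (divn_small s1) (divn_small s2).
have er0 : (r * n0 + (c + (mu - z)) = r' * n0 + (c' + (mu - z')))%N.
  by move: key; rewrite eb => /addIn.
have n0_gt0 : (0 < n0)%N by lia.
have er : r = r'.
  have := congr1 (divn^~ n0) er0.
  by rewrite !divnMDl // !divn_small ?addn0 //; lia.
have ej : j = j' :> nat.
  have : (mu * (m.-1 - j) == mu * (m.-1 - j') %[mod m])%N by rewrite E E' er !modnMDl.
  rewrite -(eqn_modDr 0); wlog le_jj : j j' {E E' Eq} / (j <= j')%N.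
    move=> W; case/orP: (leq_total j j') => [/W//|/W W' /eqP Ejj].
    by symmetry; apply: W'; rewrite Ejj.
  rewrite !addn0 eqn_mod_dvd ?leq_mul2l; last by lia.
  rewrite -mulnBr Gauss_dvdr // => /dvdn_leq; have := ltn_ord j'; lia.
have ez : z = z'.
  have m_gt0 : (0 < m)%N by lia.
  by apply/eqP; rewrite -(eqn_pmul2r m_gt0); move: E; rewrite ej E' er; lia.
move: eb er0; rewrite ez er => eb er0.
by congr (_, _, _); apply: val_inj => //=; lia.
Qed.

Lemma expr_sum_pchar (R : comNzRingType) (I : finType) (f : I -> R) M :
  [pchar R].-nat M -> (\sum_i f i) ^+ M = \sum_i f i ^+ M.
Proof.
move=> chM; have /andP[M_gt0 _] := chM.
rewrite (big_morph (fun x => x ^+ M) (op1 := +%R) (id1 := 0)) //.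
  by move=> x y; rewrite exprDn_pchar.
by rewrite expr0n eqn0Ngt M_gt0.
Qed.

Lemma size_exp_le (R : nzRingType) (p : {poly R}) d k :
  (size p <= d.+1 -> size (p ^+ k) <= (k * d).+1)%N.
Proof.
move=> le_p; apply: leq_trans (size_poly_exp_leq _ _) _.
rewrite ltnS mulnC leq_mul2l; lia.
Qed.

Lemma closed_root_exists (K : closedFieldType) M (v : K) :
  (0 < M)%N -> exists w : K, w ^+ M == v.
Proof.
move=> M_gt0; have [|w] := closed_rootP ('X^M - v%:P) _.
  by rewrite size_XnsubC // eqSS -lt0n.
by rewrite /root !hornerE subr_eq0; exists w.
Qed.

(* The auxiliary polynomial is psi = sum_i w_i p_i, where p_i is
   A^(j n0) B^((m-1-j) n0) X^(c + M b).  On S, X^(M^2) and (A/B)^(n0 (M+1)) are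
   known, so psi^M coincides there, up to a unit, with the much smaller polynomial
   sum_i w_i^M q_i, and the w_i can be chosen, not all zero, to make the latter
   vanish identically.  The p_i have distinct valuations at 0, so psi != 0. *)
Lemma stepanov (K : closedFieldType) (M m n0 mu delta a bn : nat)
    (A B' : {poly K}) (kappa zeta : K) (S : seq K) :
  let B := 'X^mu * B' in
  [pchar K].-nat M -> M = (m * n0).+1 -> coprime m mu ->
  A`_0 != 0 -> B'`_0 != 0 -> (size A <= delta.+1)%N -> (size B <= delta.+1)%N ->
  uniq S ->
  (forall x, x \in S -> [/\ x ^+ (M * M) = x + kappa, A.[x] != 0 &
     A.[x] ^+ (n0 * M.+1) = zeta * B.[x] ^+ (n0 * M.+1)]) ->
  (a + mu <= n0)%N -> (M * (delta + a) + bn < m * bn * a)%N ->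
  (size S <= M * delta + a + M * bn)%N.
Proof.
move=> B chM defM co_mu A0 B'0 szA szB uniqS rootS le_a dims.
have M_gt0 : (0 < M)%N by rewrite defM.
pose I := ('I_m * 'I_bn * 'I_a)%type.
have I_lt (i : I) : [/\ (i.1.1 < m)%N, (i.1.2 < bn)%N & (i.2 < a)%N] by rewrite !ltn_ord.
pose q (i : I) := zeta ^+ i.1.1 *: (B ^+ (n0 * i.1.1) * A ^+ (n0 * (m.-1 - i.1.1))
  * 'X^(i.2 * M) * ('X + kappa%:P) ^+ i.1.2).
pose p (i : I) := A ^+ (i.1.1 * n0) * B ^+ ((m.-1 - i.1.1) * n0) * 'X^(i.2 + M * i.1.2).
have size_mul (f g : {poly K}) s t : (size f <= s.+1 -> size g <= t.+1 ->
    size (f * g)%R <= (s + t).+1)%N.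
  by move=> *; apply: leq_trans (size_polyMleq _ _) _; lia.
(* Each q_i has size at most M (delta + a) + bn, since (m-1) n0 <= M, c < a and b < bn, and there
   are m bn a of them. *)
have [||v [i0 v0] sum0] := @poly_family_dependent K I q (M * (delta + a) + bn).
- move=> i; have [lt1 lt2 lt3] := I_lt i; apply: leq_trans (size_scale_leq _ _) _.
  apply: (@leq_trans ((n0 * i.1.1) * delta + (n0 * (m.-1 - i.1.1)) * delta + i.2 * M + i.1.2 * 1).+1).
    apply: (size_mul _ _ _ (i.1.2 * 1)%N); last first.
      by apply: size_exp_le; rewrite size_XaddC.
    apply: (size_mul _ _ _ (i.2 * M)%N); last by rewrite size_polyXn.
    by apply: (size_mul _ _ (n0 * i.1.1 * delta)%N); apply: size_exp_le.
  have -> : (n0 * i.1.1 * delta + n0 * (m.-1 - i.1.1) * delta = n0 * m.-1 * delta)%N.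
    by rewrite -mulnDl -mulnDr subnKC // -ltnS (ltn_predK lt1).
  have : (n0 * m.-1 * delta <= M * delta)%N by rewrite leq_mul2r; apply/orP; right; rewrite defM; nia.
  have : (i.2.+1 * M <= a * M)%N by rewrite leq_mul2r lt3 orbT.
  rewrite mulSn mulnDr; move: lt2; move: (nat_of_ord i.1.2) (nat_of_ord i.2 * M)%N (n0 * _ * _)%N => u1 u2 u3.
  lia.
- by rewrite !card_prod !card_ord.
(* Taking M-th roots of the coefficients of the relation makes it comparable with psi^M, the M-th
   power being additive. *)
have /fin_all_exists [w wE] (i : I) : exists w, w ^+ M == v i.
  exact: closed_root_exists.
have nz_psi : \sum_i w i *: p i != 0.
  apply/eqP => psi0; case/negP: v0; rewrite -(eqP (wE i0)).
  have -> : w i0 = 0; last by rewrite expr0n eqn0Ngt M_gt0.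
  pose h (i : I) := A ^+ (i.1.1 * n0) * B' ^+ ((m.-1 - i.1.1) * n0).
  have inj := stepanov_exponent_inj (bn := bn) co_mu le_a.
  apply: (distinct_valuations_free (h := h) inj) => [i|].
    by rewrite -horner_coef0 hornerM !horner_exp !horner_coef0 mulf_neq0 // expf_neq0.
  rewrite -[RHS]psi0; apply: eq_bigr => i _; congr (_ *: _).
  rewrite /h /p /B exprMn -exprM -defM exprD mulnA.
  by rewrite -!mulrA; ring.
clearbody B.
have roots_psi : all (root (\sum_i w i *: p i)) S.
  apply/allP => x /rootS [xM Ax0 ABx]; rewrite /root.
  have <- : ((\sum_i w i *: p i).[x] ^+ M == 0) = ((\sum_i w i *: p i).[x] == 0) by rewrite expf_eq0 M_gt0.
  rewrite horner_sum expr_sum_pchar //.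
  (* Multiplied by A(x)^((m-1) n0), each p_i(x)^M becomes B(x)^((m-1) n0 M) q_i(x), up to the
     coefficients, by the known value of A(x)^(n0 (M+1)). *)
  have : A.[x] ^+ (m.-1 * n0) != 0 by rewrite expf_neq0.
  move/mulIf/inj_eq <-; rewrite mul0r big_distrl /=.
  have /(congr1 (fun f : {poly K} => B.[x] ^+ (m.-1 * n0 * M) * f.[x])) := sum0.
  rewrite horner0 mulr0 horner_sum big_distrr /= => sum0'; apply/eqP.
  rewrite -[RHS]sum0'; apply: eq_bigr => i _.
  have [lt1 _ _] := I_lt i.
  have Em : (m.-1 = (m.-1 - i.1.1) + i.1.1)%N by rewrite subnK // -ltnS (ltn_predK lt1).
  rewrite /p /q !hornerE !exprMn (eqP (wE i)) -!exprM.
  have /(congr1 (fun y => y ^+ i.1.1)) := ABx; rewrite exprMn -!exprM => ABj.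
  have -> : x ^+ ((i.2 + M * i.1.2) * M) = x ^+ (i.2 * M) * (x + kappa) ^+ i.1.2.
    by rewrite -xM -exprM -exprD; congr (_ ^+ _); lia.
  move: ABj; move: (A.[x]) (B.[x]) => s t ABj.
  set k := (m.-1 - i.1.1)%N in Em *; set j := nat_of_ord i.1.1 in Em ABj *.
  have -> : s ^+ (m.-1 * n0) = s ^+ (j * n0) * s ^+ (k * n0).
    by rewrite -exprD Em; congr (_ ^+ _); lia.
  have -> : t ^+ (m.-1 * n0 * M) = t ^+ (j * n0 * M) * t ^+ (k * n0 * M).
    by rewrite -exprD Em; congr (_ ^+ _); lia.
  have {}ABj : s ^+ (j * n0 * M) * s ^+ (j * n0) =
      zeta ^+ j * (t ^+ (j * n0 * M) * t ^+ (j * n0)).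
    by rewrite -!exprD; have -> : (j * n0 * M + j * n0 = n0 * M.+1 * j)%N by lia.
  rewrite ![(n0 * _)%N]mulnC /=.
  transitivity (s ^+ (j * n0 * M) * s ^+ (j * n0) * v i * s ^+ (k * n0) *
    t ^+ (k * n0 * M) * (x ^+ (i.2 * M) * (x + kappa) ^+ i.1.2)); first by ring.
  by rewrite ABj; ring.
rewrite -ltnS; apply: leq_trans (max_poly_roots nz_psi roots_psi uniqS) _.
apply: leq_trans (size_sum _ _ _) _; apply/bigmax_leqP => i _.
have [lt1 lt2 lt3] := I_lt i; apply: leq_trans (size_scale_leq _ _) _.
apply: leq_trans (size_mul _ _ (i.1.1 * n0 * delta + (m.-1 - i.1.1) * n0 * delta)%N
  (i.2 + M * i.1.2)%N _ _) _; last 2 first.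
- by rewrite size_polyXn.
- have -> : (i.1.1 * n0 * delta + (m.-1 - i.1.1) * n0 * delta = m.-1 * n0 * delta)%N.
    by rewrite -!mulnDl subnKC // -ltnS (ltn_predK lt1).
  have : (m.-1 * n0 * delta <= M * delta)%N.
    by rewrite leq_mul2r; apply/orP; right; rewrite defM; nia.
  have : (M * i.1.2 <= M * bn)%N by rewrite leq_mul2l (ltnW lt2) orbT.
  move: lt3; move: (nat_of_ord i.2) (M * _)%N (_ * n0 * delta)%N => *; lia.
by apply: (size_mul _ _ (i.1.1 * n0 * delta)%N); apply: size_exp_le.
Qed.
(** This is the dimension condition of [stepanov] for bn = n0 + c1, with D standing for m (n0 - mu).
    The right side minus the left is M (c2 + 1) - c2 n0 - c1 c2, which is at least M - c1 c2 > 0. *)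
Lemma stepanov_dims M D c1 c2 n0 delta :
  (D + c2 = M.+1 -> c1 = (delta + c2).+1 -> c1 * c2 < M -> n0 <= M ->
   M * (delta + n0) + (n0 + c1) < D * (n0 + c1))%N.
Proof.
move=> ED Ec ltM le_n0; rewrite -(ltn_add2r (c2 * (n0 + c1))) -mulnDl ED.
rewrite mulSn [in X in (_ < X)%N]mulnDr {4}Ec -addSn !mulnDr.
have : (c2 * n0 <= M * c2)%N by rewrite mulnC leq_mul2r le_n0 orbT.
rewrite [(c2 * c1)%N]mulnC mulnS !mulnDr.
move: (c2 * n0)%N (M * c2)%N (c1 * c2)%N (M * n0)%N (M * delta)%N ltM => *; lia.
Qed.

Lemma stepanov_total M m n0 delta c1 : M = (m * n0).+1 ->
  (m * (M * delta + n0 + M * (n0 + c1)) <= M * M + m * (delta + c1) * M)%N.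
Proof.
move=> defM; have E : (m * n0 * M + M = M * M)%N by rewrite {3}defM mulSn addnC.
have le : (m * n0 <= M)%N by rewrite defM.
have -> : (m * (M * delta + n0 + M * (n0 + c1)) =
  m * n0 * M + m * n0 + m * (delta + c1) * M)%N by clear; lia.
by rewrite leq_add2r -E leq_add2l.
Qed.

(** The parameters a = n0 - mu and bn = n0 + c1 balance the degree of psi against the number of
    unknowns. C and M0 depend on m, mu and delta alone, so that they serve all extensions of the
    base field at once. *)
Lemma stepanov_bound (m mu delta : nat) : (0 < m)%N -> coprime m mu ->
  exists C M0 : nat, forall (K : closedFieldType) (M n0 : nat) (A B' : {poly K})
    (x0 zeta : K) (S : seq K),
  let B := ('X - x0%:P) ^+ mu * B' in
  [pchar K].-nat M -> M = (m * n0).+1 -> (M0 <= M)%N ->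
  A.[x0] != 0 -> B'.[x0] != 0 -> (size A <= delta.+1)%N -> (size B <= delta.+1)%N ->
  uniq S ->
  (forall x, x \in S -> [/\ x ^+ (M * M) = x, A.[x] != 0 &
     A.[x] ^+ (n0 * M.+1) = zeta * B.[x] ^+ (n0 * M.+1)]) ->
  (m * size S <= M * M + C * M)%N.
Proof.
move=> m_gt0 co_mu; pose c2 := (2 + m * mu)%N; pose c1 := (delta + c2).+1.
exists (m * (delta + c1))%N, (c1 * c2 + m * mu + 2)%N.
move=> K M n0 A B' x0 zeta S B chM defM leM A0 B'0 szA szB uniqS rootS.
have le_mu : (mu <= n0)%N.
  by rewrite -(leq_pmul2l m_gt0); lia.
(* Translation moves x0 to 0. It turns x^(M^2) = x into the relation t^(M^2) = t + kappa for t = x -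
   x0, with kappa = x0 - x0^(M^2), since x0 itself need not be fixed. *)
pose sh (p : {poly K}) := p \Po ('X + x0%:P).
have sz_sh p : size (sh p) = size p by rewrite size_comp_poly2 // size_XaddC.
have shE p x : (sh p).[x - x0] = p.[x] by rewrite horner_comp !hornerE subrK.
have sh0 p : (sh p)`_0 = p.[x0] by rewrite -horner_coef0 -[0](subrr x0) shE.
have shB : 'X^mu * sh B' = sh B.
  by rewrite /sh comp_polyM rmorphXn /= comp_polyB comp_polyX comp_polyC addrK.
have := @stepanov K M m n0 mu delta (n0 - mu) (n0 + c1) (sh A) (sh B')
  (x0 - x0 ^+ (M * M)) zeta [seq x - x0 | x <- S].
rewrite shB; cbv zeta; rewrite !sz_sh !sh0 size_map subnK // map_inj_uniq; last exact: addIr.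
move=> /(_ chM defM co_mu A0 B'0 szA szB uniqS) le_S.
have : (size S <= M * delta + (n0 - mu) + M * (n0 + c1))%N.
  apply: le_S => // [x /mapP[y /rootS [yM Ay ABy] ->]|].
    rewrite !shE; split=> //.
    have chMM : [pchar K].-nat (M * M)%N by rewrite pnatM chM.
    have := exprDn_pchar (y - x0) x0 chMM; rewrite subrK yM => Ey.
    by apply: (addIr (x0 ^+ (M * M))); rewrite -Ey; ring.
  have ED : (m * (n0 - mu) + c2 = M.+1)%N by rewrite mulnBr /c2; lia.
  rewrite mulnAC; apply: leq_ltn_trans (stepanov_dims (n0 := n0) ED (erefl c1) _ _).
  - by rewrite leq_add2r leq_mul2l leq_add2l leq_subr orbT.
  - by lia.
  - by rewrite defM leqW // leq_pmull.
move: (size S) => z le_z.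
apply: leq_trans (stepanov_total delta c1 defM).
by rewrite leq_mul2l; apply/orP; right; lia.
Qed.

(** * Newton's identities and reciprocal roots *)

(** For E = sum_k e_k T^k this says T E' = E sum_(i > 0) p_i T^i. With this sign, the p_i of a
    product of factors 1 - w T are minus the power sums. *)
Definition newton (R : nzRingType) (p e : nat -> R) :=
  forall k, e k.+1 *+ k.+1 = \sum_(i < k.+1) p i.+1 * e (k - i)%N.

Lemma newton_unique (R : nzRingType) (p p' e : nat -> R) :
  e 0%N = 1 -> newton p e -> newton p' e -> forall k, p k.+1 = p' k.+1.
Proof.
move=> e0 Np Np' k; elim/ltn_ind: k => k IH.
have := Np k; rewrite (Np' k) !big_ord_recr /= subnn e0 !mulr1.
by rewrite (eq_bigr (fun i : 'I_k => p i.+1 * e (k - i)%N)) => [/addrI ->|i _] //; rewrite IH.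
Qed.

Section EulerProduct.
Variable R : comNzRingType.
Implicit Types (ws : seq R) (E : {poly R}).

Definition euler ws : {poly R} := \prod_(w <- ws) (1 - w *: 'X).

Lemma coef_euler_factor w E k :
  ((1 - w *: 'X) * E)`_k.+1 = E`_k.+1 - w * E`_k.
Proof. by rewrite mulrBl mul1r -scalerAl coefB coefZ coefXM. Qed.

Lemma euler0 ws : (euler ws)`_0 = 1.
Proof.
rewrite -horner_coef0 horner_prod big1 // => w _.
by rewrite !hornerE; ring.
Qed.

(** Induction on the factors. For the new factor 1 - w T, [tele] evaluates the contribution of the
    powers of w as a telescoping sum, and [main] that of the remaining ones by the induction
    hypothesis. *)
Lemma newton_euler ws :
  newton (fun i => - \sum_(w <- ws) w ^+ i) (fun k => (euler ws)`_k).
Proof.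
elim: ws => [|w ws IH] k.
  rewrite /euler big_nil coef1 mul0rn big1 // => i _.
  by rewrite big_nil oppr0 mul0r.
set E := euler ws in IH *; rewrite {1 2}/euler big_cons -/(euler ws) -/E.
set E' := _ * E; pose p i := - \sum_(w <- ws) w ^+ i.
have E'S j : E'`_j.+1 = E`_j.+1 - w * E`_j by exact: coef_euler_factor.
have E'0 : E'`_0 = E`_0 by rewrite /E' mulrBl mul1r -scalerAl coefB coefZ coefXM mulr0 subr0.
have tele : \sum_(i < k.+1) w ^+ i.+1 * E'`_(k - i) = w * E`_k.
  elim: (k) => [|j IHj]; first by rewrite big_ord1 E'0 expr1.
  rewrite big_ord_recl /= subn0 E'S expr1.
  under eq_bigr => i _ do rewrite /bump /= add1n subSS exprS -mulrA.
  by rewrite -big_distrr /= IHj; ring.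
have main : \sum_(i < k.+1) p i.+1 * E'`_(k - i) = E`_k.+1 *+ k.+1 - w * (E`_k *+ k).
  rewrite (IH k) !big_ord_recr /= subnn E'0 addrAC; congr (_ + _).
  case: (k) => [|j]; first by rewrite !big_ord0 mulr0n mulr0 subr0.
  rewrite (IH j) big_distrr /= -sumrB; apply: eq_bigr => i _.
  by rewrite subSn -1?ltnS // E'S /p; ring.
rewrite (eq_bigr (fun i : 'I_k.+1 => p i.+1 * E'`_(k - i) - w ^+ i.+1 * E'`_(k - i))).
  by rewrite sumrB main tele E'S mulrnBl -mulrnAr (mulrS _ k); ring.
by move=> i _; rewrite big_cons /p; ring.
Qed.

Lemma size_euler ws : (size (euler ws) <= (size ws).+1)%N.
Proof.
elim: ws => [|w ws IH]; first by rewrite /euler big_nil size_poly1.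
rewrite /euler big_cons; apply: leq_trans (size_polyMleq _ _) _.
have : (size (1 - w *: 'X)%R <= 2)%N.
  apply: leq_trans (size_polyD _ _) _; rewrite size_polyN geq_max size_poly1 /=.
  by apply: leq_trans (size_scale_leq _ _) _; rewrite size_polyX.
rewrite -/(euler ws) /=; move: IH.
by move: (size _) (size _) (size _) => x y z; lia.
Qed.

Lemma euler_rev ws k : (k <= size ws)%N ->
  (euler ws)`_k = (\prod_(w <- ws) ('X - w%:P))`_(size ws - k).
Proof.
elim: ws k => [|w ws IH] [|k] le_k.
- by rewrite /euler !big_nil.
- by [].
- rewrite euler0 subn0; have /eqP := monic_prod_XsubC (w :: ws) xpredT id.
  by rewrite /lead_coef size_prod_XsubC.
rewrite /euler !big_cons -/(euler ws) coef_euler_factor [size _]/= subSS.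
rewrite mulrBl coefB coefXM mul_polyC coefZ (IH k) //.
move: le_k; rewrite ltnS leq_eqVlt => /orP[/eqP ->|lt_k].
  rewrite subnn; congr (_ - _); apply/leq_sizeP: (leqnn (size ws).+1) => //.
  exact: size_euler.
by rewrite IH // subn_eq0 leqNgt lt_k /= subnS.
Qed.
End EulerProduct.

(* A polynomial p isolating v among the distinct elements of ws turns the power
   sums into a multiple of v^i, whose growth they therefore control. *)
Lemma power_sum_bound (ws : seq algC) (C Q : algC) (i0 : nat) : 0 < Q ->
  (forall i, (i0 <= i)%N -> `|\sum_(w <- ws) w ^+ i| <= C * Q ^+ i) ->
  forall v, v \in ws -> `|v| <= Q.
Proof.
move=> Q_gt0 bound v vws.
pose p : {poly algC} := \prod_(u <- rem v (undup ws)) ('X - u%:P).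
have pv : p.[v] != 0.
  by rewrite -[_ != 0]/(~~ root p v) root_prod_XsubC mem_rem_uniqF ?undup_uniq //.
have pu u : u \in ws -> u != v -> p.[u] = 0.
  move=> uws uv; apply/eqP; rewrite -[_ == 0]/(root p u) root_prod_XsubC.
  by rewrite mem_rem_uniq ?undup_uniq // inE uv mem_undup.
have key i : \sum_(l < size p) p`_l * (\sum_(w <- ws) w ^+ (i + l)) =
    v ^+ i * p.[v] *+ count_mem v ws.
  under eq_bigr => l _ do rewrite big_distrr /=.
  rewrite exchange_big /=.
  transitivity (\sum_(u <- ws | u == v) v ^+ i * p.[v]).
    rewrite [RHS]big_mkcond big_seq [RHS]big_seq; apply: eq_bigr => u uws.
    have -> : \sum_(l < size p) p`_l * u ^+ (i + l) = u ^+ i * p.[u].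
      by rewrite horner_coef big_distrr; apply: eq_bigr => l _; rewrite exprD /=; ring.
    by case: eqVneq => [->|/pu->] //; rewrite mulr0.
  by rewrite big_const_seq iter_addr_0.
pose D := \sum_(l < size p) `|p`_l| * C * Q ^+ l; pose c := `|p.[v] *+ count_mem v ws|.
have c_gt0 : 0 < c.
  by rewrite normr_gt0 -mulr_natr mulf_neq0 // pnatr_eq0 -lt0n -has_count has_pred1.
have {key bound} bound i : (i0 <= i)%N -> `|v| ^+ i * c <= D * Q ^+ i.
  move=> le_i; rewrite -normrX -normrM mulrnAr -key (le_trans (ler_norm_sum _ _ _)) //.
  rewrite big_distrl ler_sum //= => l _; rewrite normrM -!mulrA ler_wpM2l //.
  by rewrite -exprD [(l + i)%N]addnC; apply: bound (leq_trans le_i (leq_addr _ _)).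
rewrite real_leNgt ?normr_real ?(gtr0_real Q_gt0) //.
(* If |v| > Q, the powers of r = |v| / Q > 1 would stay below D / c, against Bernoulli's
   inequality. *)
apply/negP => ltQ; pose r := `|v| / Q.
have r_gt1 : 1 < r by rewrite ltr_pdivlMr // mul1r.
have boundr i : (i0 <= i)%N -> r ^+ i * c <= D.
  move=> /bound; rewrite -ler_pdivrMr ?exprn_gt0 //.
  by rewrite /r expr_div_n mulrAC.
have bern i : i%:R * (r - 1) <= r ^+ i.
  elim: i => [|i IHi]; first by rewrite mul0r expr0 ler01.
  have r_ge1 : 1 <= r ^+ i by rewrite exprn_ege1 // ltW.
  rewrite exprS -natr1 mulrDl mul1r (_ : r * r ^+ i = r ^+ i + (r - 1) * r ^+ i); last by ring.
  by rewrite lerD // -[leLHS]mulr1 ler_wpM2l // subr_ge0 ltW.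
have D_ge0 : 0 <= D.
  by apply: le_trans (boundr i0 (leqnn _)); rewrite mulr_ge0 ?exprn_ge0 ?ltW // (lt_trans ltr01).
pose x := D / ((r - 1) * c).
have x_ge0 : 0 <= x by apply: divr_ge0 => //; apply: mulr_ge0; rewrite ?subr_ge0 ltW.
pose N := maxn i0 (Num.bound x).
have : D < N%:R * (r - 1) * c.
  rewrite -mulrA -ltr_pdivrMr ?mulr_gt0 ?subr_gt0 //.
  apply: lt_le_trans (archi_boundP x_ge0) _.
  by rewrite ler_nat leq_maxr.
move/lt_geF/negbT/negP; apply; apply: le_trans (boundr N (leq_maxl _ _)).
by rewrite ler_wpM2r // ltW.
Qed.

(** Newton's identities give S_k = - sum_w w^k for the reciprocal roots w of sum_k e_k T^k. The
    bound on even indices is a bound on the power sums of the w^2, so |w|^2 <= Q for each of the r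
    roots. *)
Lemma trace_bound (S e : nat -> algC) (r : nat) (C Q : algC) (i0 : nat) :
  0 < Q -> e 0%N = 1 -> (forall k, (r < k)%N -> e k = 0) -> newton S e ->
  (forall i, (i0 <= i)%N -> `|S (2 * i)%N| <= C * Q ^+ i) ->
  `|S 1%N| <= r%:R * sqrtC Q.
Proof.
move=> Q_gt0 e0 e_r Nse bound.
(* The reversed polynomial is monic of degree exactly r since e_0 = 1; when e_r = 0, some of its
   roots are 0. *)
pose p : {poly algC} := \poly_(k < r.+1) e (r - k)%N.
have lead_p : lead_coef p = 1 by rewrite lead_coef_poly // subnn e0 ?oner_neq0.
have size_p : size p = r.+1 by rewrite size_poly_eq // subnn e0 oner_neq0.
have [ws] := closed_field_poly_normal p; rewrite lead_p scale1r => defp.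
have size_ws : size ws = r by apply: succn_inj; rewrite -size_p defp size_prod_XsubC.
have eE k : e k = (euler ws)`_k.
  have [le_k|lt_k] := leqP k r; last first.
    by rewrite e_r // nth_default // (leq_trans (size_euler _)) // size_ws.
  by rewrite euler_rev size_ws // -defp coef_poly ltnS leq_subr subKn.
have SE k : S k.+1 = - \sum_(w <- ws) w ^+ k.+1.
  apply: (newton_unique (p' := fun i => - \sum_(w <- ws) w ^+ i) e0 Nse) => j; have := newton_euler ws j.
  by rewrite -eE => ->; apply: eq_bigr => i _; rewrite eE.
have ws_le w : w \in ws -> `|w| <= sqrtC Q.
  move=> /(map_f (fun u => u ^+ 2)) w2.
  rewrite -(@ler_pXn2r _ 2) ?nnegrE ?sqrtC_ge0 ?(ltW Q_gt0) // sqrtCK -normrX.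
  (* Index 0 is avoided because Newton's identities do not determine S_0. *)
  apply: (power_sum_bound (i0 := i0.+1) Q_gt0 _ w2) => -[//|i] le_i.
  rewrite big_map; apply: le_trans (bound i.+1 (ltnW le_i)).
  under eq_bigr => u _ do rewrite -exprM mulnS.
  by rewrite mulnS SE normrN.
rewrite SE normrN (le_trans (ler_norm_sum _ _ _)) // -size_ws mulr_natl.
have <- : \sum_(w <- ws) sqrtC Q = sqrtC Q *+ size ws.
  by rewrite big_const_seq count_predT iter_addr_0.
by rewrite big_seq [leRHS]big_seq; apply: ler_sum => w wws; rewrite expr1 ws_le.
Qed.

(** * Frobenius orbits in the algebraic closure *)

Lemma natr_pchar0 (R : nzRingType) N : [pchar R].-nat N -> (1 < N)%N -> N%:R = 0 :> R.
Proof.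
move=> chN N_gt1.
have /andP[_ /eqP p0] : pdiv N \in [pchar R] by apply: (pnatPpi chN); rewrite pi_pdiv.
by rewrite -(divnK (pdiv_dvd N)) natrM p0 mulr0.
Qed.

Section FiniteField.
Variables (F : finFieldType) (K : closedFieldType) (iota : {rmorphism F -> K}).
Variable phi : {rmorphism K -> K}.
Local Notation Q := #|F|.
Hypothesis phiE : forall x, phi x = x ^+ Q.
Hypothesis chQ : [pchar K].-nat Q.
Local Notation "p ^i" := (map_poly iota p) (at level 2, format "p ^i").

(* Junk value 0 outside the image of iota. *)
Definition iinv (w : K) : F := odflt 0 [pick x | iota x == w].

Lemma iinvK : cancel iota iinv.
Proof.
move=> x; rewrite /iinv; case: pickP => [y /eqP/fmorph_inj //|/(_ x)].
by rewrite eqxx.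
Qed.

Lemma phi_iota x : phi (iota x) = iota x.
Proof. by rewrite phiE -rmorphXn expf_card. Qed.

Lemma iinvE w : phi w = w -> iota (iinv w) = w.
Proof.
rewrite phiE => wQ; suff [x ->] : exists x, w = iota x by rewrite iinvK.
have : root ('X^Q - 'X)^i w.
  by rewrite rmorphB rmorphXn /= map_polyX /root !hornerE wQ subrr.
rewrite finField_genPoly rmorph_prod /root horner_prod.
rewrite prodf_seq_eq0 => /hasP[x _]; rewrite /= rmorphB /= map_polyX map_polyC.
by rewrite !hornerE subr_eq0 => /eqP ->; exists x.
Qed.

Lemma iter_phi l x : iter l phi x = x ^+ (Q ^ l).
Proof. by elim: l => [|l IH] /=; rewrite ?expn0 ?expr1 // IH phiE expnSr exprM. Qed.

Lemma phi_inj : injective phi. Proof. exact: fmorph_inj. Qed.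

Lemma iter_phi_inj l : injective (iter l phi).
Proof. by elim: l => [|l IH] x y //= /phi_inj/IH. Qed.

Lemma Q_gt1 : (1 < Q)%N. Proof. exact: finNzRing_gt1. Qed.

Lemma Q_exp_gt1 i : (1 < Q ^ i.+1)%N.
Proof. by rewrite -[1%N](expn0 Q) ltn_exp2l // Q_gt1. Qed.

(** For i > 0, the elements of the subfield of K with Q^i elements. For i = 0 the polynomial is
    zero, hence the index [i.+1] in the lemmas below. *)
Definition fixpts i : seq K := sval (closed_field_poly_normal ('X^(Q ^ i) - 'X)).

Lemma fixptsE i : 'X^(Q ^ i.+1) - 'X = \prod_(z <- fixpts i.+1) ('X - z%:P) :> {poly K}.
Proof.
rewrite /fixpts; case: closed_field_poly_normal => r /= {1}->.
rewrite (_ : lead_coef _ = 1) ?scale1r // lead_coefDl ?lead_coefXn //.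
by rewrite size_polyN size_polyX size_polyXn ltnS Q_exp_gt1.
Qed.

Lemma mem_fixpts i x : (x \in fixpts i.+1) = (iter i.+1 phi x == x).
Proof. by rewrite -root_prod_XsubC -fixptsE /root !hornerE subr_eq0 iter_phi. Qed.

Lemma size_fixpts i : size (fixpts i.+1) = (Q ^ i.+1)%N.
Proof.
apply: succn_inj; rewrite -(size_prod_XsubC _ id) -fixptsE size_polyDl size_polyXn //.
by rewrite size_polyN size_polyX ltnS Q_exp_gt1.
Qed.

Lemma uniq_fixpts i : uniq (fixpts i.+1).
Proof.
rewrite -separable_prod_XsubC -fixptsE unlock derivB derivXn derivX.
rewrite -scaler_nat expnS natrM (natr_pchar0 chQ Q_gt1) mul0r scale0r sub0r -[X in coprimep _ X]scaleN1r.
by rewrite coprimepZr ?coprimep1 // oppr_eq0 oner_neq0.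
Qed.

Definition orbit_poly i x : {poly K} := \prod_(l < i) ('X - (iter l phi x)%:P).

(* If x has degree d over F and d divides i, this is the (i/d)-th power of the
   minimal polynomial of x. *)
Definition cyc i x : {poly F} := map_poly iinv (orbit_poly i x).

(** When x is fixed by the i-th iterate, phi rotates the factors of the orbit polynomial, so its
    coefficients are fixed by phi and come from F. *)
Lemma cycE i x : iter i phi x = x -> (cyc i x)^i = orbit_poly i x.
Proof.
move=> fix_x; have phi_orbit : map_poly phi (orbit_poly i x) = orbit_poly i x.
  rewrite /orbit_poly rmorph_prod /=.
  under eq_bigr => l _ do rewrite rmorphB /= map_polyX map_polyC /=.
  case: i fix_x => [|i] fix_x; first by rewrite !big_ord0.
  by rewrite big_ord_recr [RHS]big_ord_recl /= -[phi _]/(iter i.+1 phi x) fix_x mulrC.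
apply/polyP => l; rewrite coef_map /= coef_map_id0; last by rewrite -(rmorph0 iota) iinvK.
by rewrite iinvE // -[in RHS]phi_orbit coef_map.
Qed.

Lemma monic_orbit_poly i x : orbit_poly i x \is monic.
Proof. exact: monic_prod_XsubC. Qed.

Lemma size_orbit_poly i x : size (orbit_poly i x) = i.+1.
Proof. by rewrite size_prod_XsubC /index_enum -enumT size_enum_ord. Qed.

Lemma cyc_monic i x : iter i phi x = x -> cyc i x \is monic.
Proof. by move=> /cycE E; rewrite -(map_monic iota) E monic_orbit_poly. Qed.

Lemma size_cyc i x : iter i phi x = x -> size (cyc i x) = i.+1.
Proof. by move=> /cycE E; rewrite -(size_map_poly iota) E size_orbit_poly. Qed.

Lemma map_phi_iota (g : {poly F}) : map_poly phi g^i = g^i.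
Proof. by apply/polyP => l; rewrite !coef_map /= phi_iota. Qed.

Lemma root_iter_phi (g : {poly F}) l x : root g^i (iter l phi x) = root g^i x.
Proof.
elim: l => //= l <-; rewrite -[in LHS](map_phi_iota g) /root horner_map.
by rewrite fmorph_eq0.
Qed.

(** All iterates of x are roots of g, so two of them coincide. Injectivity of phi brings the
    coincidence back to x, and the least period has distinct iterates. *)
Lemma orbit_period (g : {poly F}) x : g != 0 -> root g^i x ->
  exists2 d, (0 < d)%N & iter d phi x = x /\ uniq (traject phi x d).
Proof.
move=> nz_g gx.
have period i l : (i < l)%N -> iter l phi x = iter i phi x -> iter (l - i) phi x = x.
  by move=> lt_il E; apply: (@iter_phi_inj i); rewrite -iterD subnKC // ltnW.
have ex_d : exists d, (0 < d)%N && (iter d phi x == x).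
  have : ~~ uniq (traject phi x (size g).+1).
    apply/negP => U; have : (size (traject phi x (size g).+1) < size g^i)%N.
      apply: max_poly_roots => //.
        by rewrite map_poly_eq0.
      by apply/allP => y /trajectP[l _ ->]; rewrite root_iter_phi.
    by rewrite size_traject size_map_poly ltnNge leqW.
  rewrite looping_uniq negbK => /trajectP[i lt_i E].
  by exists (size g - i)%N; rewrite subn_gt0 lt_i (period _ _ lt_i E) eqxx.
case: (ex_minnP ex_d) => -[//|d] /andP[_ /eqP fix_d] min_d.
exists d.+1 => //; split => //; rewrite looping_uniq.
apply/negP => /trajectP[i lt_i /(period _ _ lt_i) fix_i].
by have := min_d (d - i)%N; rewrite subn_gt0 lt_i fix_i eqxx => /(_ isT); lia.
Qed.

Section Period.
Variables (x : K) (d : nat).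
Hypotheses (d_gt0 : (0 < d)%N) (fix_d : iter d phi x = x) (uniq_d : uniq (traject phi x d)).

Lemma iter_mul_period w : iter (w * d) phi x = x.
Proof. by elim: w => // w IH; rewrite mulSn iterD IH. Qed.

Lemma iter_period i : (iter i phi x == x) = (d %| i)%N.
Proof.
apply/eqP/idP => [|/dvdnP[w ->]]; last exact: iter_mul_period.
rewrite {1}(divn_eq i d) addnC iterD iter_mul_period /dvdn => fix_r.
have : nth x (traject phi x d) (i %% d) = nth x (traject phi x d) 0.
  by rewrite !nth_traject ?ltn_mod.
by move/eqP; rewrite nth_uniq ?size_traject ?ltn_mod.
Qed.

Lemma orbit_poly_mul_period w : orbit_poly (w * d) x = orbit_poly d x ^+ w.
Proof.
elim: w => [|w IH]; first by rewrite /orbit_poly big_ord0.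
rewrite mulSn exprS -IH /orbit_poly big_split_ord /=; congr (_ * _).
by apply: eq_bigr => l _; rewrite addnC iterD fix_d.
Qed.

Lemma cyc_mul_period w : cyc (w * d) x = cyc d x ^+ w.
Proof.
apply: (@map_poly_inj _ _ iota); rewrite rmorphXn /= !cycE ?iter_mul_period //.
exact: orbit_poly_mul_period.
Qed.

Lemma orbit_poly_traject : orbit_poly d x = \prod_(y <- traject phi x d) ('X - y%:P).
Proof.
rewrite (big_nth x) size_traject big_mkord; apply: eq_bigr => l _.
by rewrite nth_traject.
Qed.

(** Here [cyc d x] is the minimal polynomial of x over F. As x is a simple root of it, each factor
    [cyc d x] removed from g removes exactly one factor X - x. *)
Lemma dvdp_cyc_exp (g : {poly F}) w :
  (cyc d x ^+ w %| g) = (('X - x%:P) ^+ w %| g^i).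
Proof.
have XdvdP : 'X - x%:P %| (cyc d x)^i.
  by rewrite cycE // dvdp_XsubCl orbit_poly_traject root_prod_XsubC -(prednK d_gt0) mem_head.
apply/idP/idP => [|].
  by rewrite -(dvdp_map iota) rmorphXn /=; apply: dvdp_trans; exact: dvdp_exp2r.
elim: w g => [|w IH] g; first by rewrite !expr0 !dvd1p.
rewrite !exprS => dvd_g.
have gx : root g^i x by rewrite -dvdp_XsubCl (dvdp_trans _ dvd_g) ?dvdp_mulr.
have : cyc d x %| g.
  rewrite -(dvdp_map iota) cycE // orbit_poly_traject uniq_roots_dvdp //.
    by apply/allP => y /trajectP[l _ ->]; rewrite root_iter_phi.
  by rewrite uniq_rootsE.
move/dvdpP => [g' defg]; rewrite {gx}defg in dvd_g *.
rewrite [g' * _]mulrC dvdp_mul2l ?monic_neq0 ?cyc_monic //; apply: IH.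
move: dvd_g; rewrite rmorphM /= cycE // orbit_poly_traject [X in _ %| X]mulrC.
rewrite -(prednK d_gt0) /= big_cons -mulrA dvdp_mul2l ?polyXsubC_eq0 //.
rewrite Gauss_dvdpr // coprimep_expl // coprimep_sym coprimep_XsubC root_prod_XsubC.
by move: uniq_d; rewrite -(prednK d_gt0) /= => /andP[].
Qed.
End Period.

Lemma card_dvdn_leq d v n : (0 < d)%N -> (v * d <= n)%N ->
  #|[set i : 'I_n | (d %| i.+1)%N && (i.+1 %/ d <= v)%N]| = v.
Proof.
move=> d_gt0 le_vd.
have lt_f (j : 'I_v) : ((j.+1 * d).-1 < n)%N.
  rewrite prednK ?muln_gt0 //; apply: leq_trans le_vd; by rewrite leq_mul2r ltn_ord orbT.
pose f j := Ordinal (lt_f j).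
have injf : injective f.
  move=> j j' /(congr1 val) /= /(congr1 S); rewrite !prednK ?muln_gt0 // => /eqP.
  by rewrite eqn_pmul2r // eqSS => /eqP/val_inj.
rewrite -[RHS](card_ord v) -cardsT -(card_imset _ injf); apply: eq_card => i.
rewrite inE; apply/idP/imsetP => [/andP[/dvdnP[w Ew]]|[j _ ->]] /=.
  rewrite Ew mulnK // => le_w; have w_gt0 : (0 < w)%N by case: (w) Ew.
  have lt_w : (w.-1 < v)%N by rewrite prednK.
  by exists (Ordinal lt_w) => //; apply: val_inj; rewrite /= prednK // -Ew.
by rewrite prednK ?muln_gt0 // dvdn_mull //= mulnK // ltn_ord.
Qed.

(* A root x of g of degree d and multiplicity v contributes i = d, 2d, ..., v d. *)
Lemma count_cyc_dvd (g : {poly F}) : g \is monic ->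
  (\sum_(i < (size g).-1) \sum_(x <- fixpts i.+1) (cyc i.+1 x %| g)%R = (size g).-1)%N.
Proof.
move=> g_mon; have nz_g := monic_neq0 g_mon.
have [r] := closed_field_poly_normal g^i.
have /eqP -> : g^i \is monic by rewrite map_monic.
rewrite scale1r => defg.
have size_r : (size g).-1 = size r by rewrite -(size_map_poly iota) defg size_prod_XsubC.
have rootr x : (x \in r) = root g^i x by rewrite defg root_prod_XsubC.
(* If [cyc i.+1 x] divides g then x is a root of g, so only the distinct roots of g contribute. *)
have sum_r i : (\sum_(x <- fixpts i.+1) (cyc i.+1 x %| g)%R =
    \sum_(x <- undup r) ((iter i.+1 phi x == x) && (cyc i.+1 x %| g)%R))%N.
  transitivity (\sum_(x <- fixpts i.+1 | x \in r) (cyc i.+1 x %| g)%R)%N.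
    rewrite [RHS]big_mkcond big_seq [RHS]big_seq; apply: eq_bigr => x.
    rewrite mem_fixpts => /eqP fix_x; case: ifP => // /negP rx.
    apply/eqP; rewrite eqb0; apply/negP => dvd_g; case: rx; rewrite rootr.
    rewrite -dvdp_XsubCl; rewrite -(dvdp_map iota) cycE // in dvd_g; apply: dvdp_trans dvd_g.
    by rewrite /orbit_poly big_ord_recl dvdp_mulr.
  transitivity (\sum_(x <- undup r | iter i.+1 phi x == x) (cyc i.+1 x %| g)%R)%N; last first.
    by rewrite big_mkcond; apply: eq_bigr => x _; case: eqP.
  rewrite -big_filter -[RHS]big_filter; apply: perm_big; apply: uniq_perm.
  - by rewrite filter_uniq // uniq_fixpts.
  - by rewrite filter_uniq // undup_uniq.
  by move=> x; rewrite !mem_filter mem_fixpts mem_undup andbC.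
under eq_bigr => i _ do rewrite sum_r.
rewrite exchange_big /= size_r.
transitivity (\sum_(x <- undup r) count_mem x r)%N; last first.
  under eq_bigr => x _ do rewrite -sum1_count big_mkcond.
  rewrite exchange_big -sum1_size /= big_seq [RHS]big_seq; apply: eq_bigr => y ry.
  rewrite -big_mkcond sum1_count (eq_count (a2 := pred1 y)) => [|x /=]; last by rewrite eq_sym.
  by rewrite count_uniq_mem ?undup_uniq // mem_undup ry.
apply: eq_big_seq => x; rewrite mem_undup => rx.
have [d d_gt0 [fix_d uniq_d]] := orbit_period nz_g (etrans (esym (rootr x)) rx).
have dvd_exp w : (cyc d x ^+ w %| g) = (w <= count_mem x r)%N.
  rewrite (dvdp_cyc_exp d_gt0 fix_d uniq_d) defg -mup_geq ?mu_prod_XsubC //.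
  by rewrite monic_neq0 ?monic_prod_XsubC.
have le_n : (count_mem x r * d <= (size g).-1)%N.
  have := dvd_exp (count_mem x r); rewrite leqnn -(cyc_mul_period fix_d) => /(dvdp_leq nz_g).
  by rewrite size_cyc ?iter_mul_period // -(ltn_predK (_ : 0 < size g)%N) ?size_poly_gt0.
rewrite -size_r -[RHS](card_dvdn_leq d_gt0 le_n) -sum1_card [RHS]big_mkcond /=.
apply: eq_bigr => i _; rewrite inE -[phi _]/(iter i.+1 phi x) (iter_period d_gt0 fix_d uniq_d).
by case: dvdnP => //= -[w Ew]; rewrite Ew (cyc_mul_period fix_d) dvd_exp mulnK //; case: leqP.
Qed.
End FiniteField.

(** * The L-function of a multiplicative function *)

Section MonicPolynomials.
Variable F : finFieldType.

(** Indexing by the vector of lower coefficients makes the monic polynomials of degree k a finite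
    type. *)
Definition mon k (v : 'rV[F]_k) : {poly F} := 'X^k + rVpoly v.

Lemma size_rVpoly k (v : 'rV[F]_k) : (size (rVpoly v) <= k)%N.
Proof. by rewrite /rVpoly size_poly. Qed.

Lemma mon_monic k (v : 'rV[F]_k) : mon v \is monic.
Proof.
rewrite monicE lead_coefDl ?lead_coefXn //.
by rewrite size_polyXn ltnS size_rVpoly.
Qed.

Lemma size_mon k (v : 'rV[F]_k) : size (mon v) = k.+1.
Proof. by rewrite size_polyDl size_polyXn // ltnS size_rVpoly. Qed.

Lemma mon_onto k (g : {poly F}) : g \is monic -> size g = k.+1 ->
  mon (poly_rV (g - 'X^k) : 'rV_k) = g.
Proof.
move=> /monicP g_mon size_g.
have sz : (size (g - 'X^k)%R <= k)%N.
  apply/leq_sizeP => j; rewrite leq_eqVlt coefB coefXn => /orP[/eqP <-|lt_j].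
    by rewrite eqxx -[k]/(k.+1.-1) -size_g -lead_coefE g_mon subrr.
  by rewrite nth_default ?size_g // gtn_eqF // subrr.
by rewrite /mon poly_rV_K // addrC subrK.
Qed.

Lemma mon_inj k : injective (@mon k).
Proof. by move=> v w /addrI /(can_inj rVpolyK). Qed.

Variables (R : comNzRingType) (X : {poly F} -> R).
Hypothesis XM : forall g h, X (g * h) = X g * X h.

(** The coefficient e_k of the L-function of X. *)
Definition Lcoef k := \sum_(v : 'rV[F]_k) X (mon v).

Lemma sum_multiples k i (c : {poly F}) : c \is monic -> size c = i.+1 -> (i <= k)%N ->
  \sum_(v : 'rV[F]_k | c %| mon v) X (mon v) = X c * Lcoef (k - i).
Proof.
move=> c_mon size_c le_ik; have nz_c := monic_neq0 c_mon.
have mon_mul (w : 'rV[F]_(k - i)) : mon (poly_rV (c * mon w - 'X^k) : 'rV_k) = c * mon w.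
  apply: mon_onto; first by rewrite monicMl ?mon_monic.
  by rewrite size_mul ?monic_neq0 ?mon_monic // size_c size_mon addSn addnS /= subnKC.
have mon_div (v : 'rV[F]_k) : c %| mon v ->
    mon (poly_rV (mon v %/ c - 'X^(k - i)) : 'rV_(k - i)) = mon v %/ c.
  move=> c_dvd; apply: mon_onto.
    by rewrite -(monicMr _ c_mon) divpK ?mon_monic.
  by rewrite size_divp // size_mon size_c -subSn.
pose f (w : 'rV[F]_(k - i)) : 'rV[F]_k := poly_rV (c * mon w - 'X^k).
pose f' (v : 'rV[F]_k) : 'rV[F]_(k - i) := poly_rV (mon v %/ c - 'X^(k - i)).
rewrite (reindex_onto f f') => [|v c_dvd]; last first.
  by apply: mon_inj; rewrite mon_mul mon_div // mulrC divpK.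
rewrite big_distrr; apply: eq_big => [w|w _]; last by rewrite mon_mul XM.
rewrite mon_mul dvdp_mulr //=; apply/eqP/mon_inj.
by rewrite mon_div ?mon_mul ?dvdp_mulr // mulrC mulpK.
Qed.

Variables (K : closedFieldType) (iota : {rmorphism F -> K}) (phi : {rmorphism K -> K}).
Hypothesis phiE : forall x, phi x = x ^+ #|F|.
Hypothesis chF : [pchar K].-nat #|F|.

(** The sum S_i of X over the extension of degree i. *)
Definition Ssum i := \sum_(x <- fixpts F K i) X (cyc iota phi i x).

(** The analogue of log n = sum of Lambda(d) over d dividing n: the degree k+1 of each monic g is
    the number of pairs (i, x) with [cyc i.+1 x] dividing g. Exchanging the sums leaves sums over
    the multiples of [cyc i.+1 x]. *)
Lemma newton_Lcoef : newton Ssum Lcoef.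
Proof.
move=> k; rewrite /Lcoef -sumrMnl.
have count (v : 'rV[F]_k.+1) : X (mon v) *+ k.+1 = \sum_(i < k.+1) \sum_(x <- fixpts F K i.+1)
    X (mon v) *+ (cyc iota phi i.+1 x %| mon v)%R.
  have := count_cyc_dvd iota phiE chF (mon_monic v); rewrite size_mon /= => count_v; rewrite -[X in _ *+ X = _]count_v.
  by rewrite -sumrMnr; apply: eq_bigr => i _; rewrite sumrMnr.
under eq_bigr => v _ do rewrite count.
rewrite exchange_big; apply: eq_bigr => i _; rewrite exchange_big /= big_distrl /=.
apply: eq_big_seq => x; rewrite (mem_fixpts phiE) => /eqP fix_x.
rewrite -subSS -sum_multiples ?(cyc_monic iota phiE fix_x) ?(size_cyc iota phiE fix_x) //.
by rewrite [RHS]big_mkcond; apply: eq_bigr => v _; case: (_ %| _).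
Qed.

Lemma Lcoef0 : X 1 = 1 -> Lcoef 0 = 1.
Proof.
move=> X1; rewrite /Lcoef (big_pred1 0) => [|v]; last by rewrite [v]thinmx0 /= eqxx.
by rewrite /mon linear0 addr0.
Qed.

End MonicPolynomials.

(* For k >= deg W, the monic polynomials of degree k are equidistributed modulo W. *)
Lemma Lcoef_eq0 (F : finFieldType) (X : {poly F} -> algC) (W g0 : {poly F}) k :
  (forall g h, X (g * h) = X g * X h) -> (forall g, X (g %% W) = X g) ->
  W != 0 -> coprimep W g0 -> X g0 != 1 -> (size W <= k.+1)%N -> Lcoef X k = 0.
Proof.
move=> XM Xmod nz_W co_g0 Xg0; have : (0 < size W)%N by rewrite size_poly_gt0.
case size_W: (size W) => [//|s] _; rewrite ltnS => le_sk.
have ltW (g : {poly F}) : (size (g %% W)%R <= s)%N by rewrite -ltnS -size_W ltn_modp.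
have smallW (r : 'rV[F]_s) : rVpoly r %% W = rVpoly r.
  by rewrite modp_small // size_W ltnS size_rVpoly.
pose T := \sum_(r : 'rV[F]_s) X (rVpoly r).
(* Multiplication by g0 permutes the residues modulo W, so X(g0) T = T with X(g0) different from
   1. *)
have T0 : T = 0.
  pose f (r : 'rV[F]_s) : 'rV[F]_s := poly_rV ((g0 * rVpoly r) %% W).
  have f_inj : injective f.
    move=> r r' /(congr1 rVpoly); rewrite !poly_rV_K // => /eqP.
    rewrite -subr_eq0 -modpN -modpD -mulrBr -[_ == 0]/(W %| _) Gauss_dvdpr //.
    by rewrite /dvdp modpD modpN !smallW subr_eq0 => /eqP/(can_inj rVpolyK).
  have : X g0 * T = T.
    rewrite [RHS](reindex_inj f_inj) big_distrr; apply: eq_bigr => r _ /=.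
    by rewrite -XM poly_rV_K // Xmod.
  move/eqP; rewrite -subr_eq0 -{2}[T]mul1r -mulrBl mulf_eq0 subr_eq0 (negPf Xg0).
  by move/eqP.
(* For k >= s, adding a polynomial of degree less than s permutes the monic polynomials of degree k.
   Averaging over these translations replaces each term by T. *)
have : Lcoef X k *+ #|{: 'rV[F]_s}| = 0.
  rewrite -sumr_const.
  transitivity (\sum_(r : 'rV[F]_s) \sum_(v : 'rV[F]_k) X (rVpoly (poly_rV (mon v %% W) + r))).
    apply: eq_bigr => r _; rewrite /Lcoef (reindex_inj (addIr (poly_rV (rVpoly r)))).
    apply: eq_bigr => v _; rewrite linearD /= poly_rV_K // -[rVpoly r in RHS]smallW -modpD Xmod.
    by rewrite /mon linearD /= addrA poly_rV_K // (leq_trans (size_rVpoly r)).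
  rewrite exchange_big big1 //= => v _; rewrite -[RHS]T0 /T.
  by rewrite [RHS](reindex_inj (addrI (poly_rV (mon v %% W)))).
move/eqP; rewrite -mulr_natr mulf_eq0 pnatr_eq0 => /orP[/eqP //|].
by rewrite -cardsT cards_eq0 => /eqP/setP/(_ 0); rewrite !inE.
Qed.

(** * Multiplicative characters *)

Lemma finField_generator (F : finFieldType) : exists z : F, (#|F|.-1).-primitive_root z.
Proof.
have n_gt0 : (0 < #|F|.-1)%N by have := finNzRing_gt1 F; case: #|F| => [|[]].
have [|||z _ prim_z] := hasP (@has_prim_root F #|F|.-1 (filter (predC1 0) (enum F)) n_gt0 _ _ _).
- apply/allP => x; rewrite mem_filter => /andP[/= nz_x _]; apply/unity_rootP.
  by apply: (mulfI nz_x); rewrite -exprS prednK ?expf_card ?mulr1 // (ltn_trans _ (finNzRing_gt1 F)).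
- by rewrite filter_uniq ?enum_uniq.
- by rewrite size_filter; have := count_predC (pred1 (0 : F)) (enum F);
     rewrite count_uniq_mem ?enum_uniq // mem_enum -cardE /= => <-.
by exists z.
Qed.

Section Character.
Variables (F : finFieldType) (z : F).
Hypothesis prim_z : (#|F|.-1).-primitive_root z.

(** The discrete logarithm to base z, with default value 0 at x = 0. *)
Definition dlog (x : F) : nat := odflt 0%N (omap val [pick i : 'I_(#|F|.-1) | z ^+ i == x]).

Lemma dlogK x : x != 0 -> z ^+ dlog x = x.
Proof.
move=> nz_x; have : x ^+ #|F|.-1 = 1.
  by apply: (mulfI nz_x); rewrite -exprS prednK ?expf_card ?mulr1 // (ltn_trans _ (finNzRing_gt1 F)).
case/(prim_rootP prim_z) => i Ex; rewrite /dlog; case: pickP => [j /eqP //|/(_ i)].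
by rewrite Ex eqxx.
Qed.

(** The character with z mapped to w, extended by 0 at 0; it is multiplicative once w^m = 1 for some
    m dividing |F| - 1. *)
Definition chi (w : algC) (x : F) : algC := if x == 0 then 0 else w ^+ dlog x.

Variables (m : nat) (w : algC).
Hypotheses (m_dvd : (m %| #|F|.-1)%N) (wm : w ^+ m = 1).

Lemma exponent_gt0 : (0 < m)%N.
Proof. by rewrite (dvdn_gt0 _ m_dvd) // (prim_order_gt0 prim_z). Qed.

Lemma dlogM x y : x != 0 -> y != 0 -> dlog (x * y) = dlog x + dlog y %[mod m].
Proof.
move=> nz_x nz_y; apply/eqP; rewrite -(modn_dvdm _ m_dvd) -[in X in _ == X](modn_dvdm _ m_dvd).
suff /eqP -> : dlog (x * y) == dlog x + dlog y %[mod #|F|.-1] by [].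
by rewrite -(eq_prim_root_expr prim_z) exprD !dlogK ?mulf_neq0.
Qed.

Lemma exp_dlog x : w ^+ dlog x = w ^+ (dlog x %% m).
Proof. by rewrite expr_mod. Qed.

Lemma chiM x y : chi w (x * y) = chi w x * chi w y.
Proof.
rewrite /chi mulf_eq0; have [|nz_x] := eqVneq x 0; first by rewrite mul0r.
have [|nz_y] := eqVneq y 0; first by rewrite mulr0.
by rewrite /= -exprD -(expr_mod _ wm) dlogM // expr_mod.
Qed.

Lemma chi1 : chi w 1 = 1.
Proof.
have : chi w 1 * (chi w 1 - 1) = 0 by rewrite mulrBr -chiM !mulr1 subrr.
move/eqP; rewrite mulf_eq0 subr_eq0 => /orP[|/eqP //].
rewrite /chi oner_eq0 expf_eq0 => /andP[_ /eqP w0]; move: wm; rewrite w0 expr0n.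
by rewrite eqn0Ngt exponent_gt0 => /eqP; rewrite eq_sym oner_eq0.
Qed.

Lemma norm_chi x : x != 0 -> `|chi w x| = 1.
Proof.
move=> nz_x; rewrite /chi (negPf nz_x) normrX.
suff -> : `|w| = 1 by rewrite expr1n.
by apply/eqP; rewrite -(pexpr_eq1 exponent_gt0) // -normrX wm normr1.
Qed.
End Character.

Lemma frobenius_rmorphism (R : comNzRingType) Q : [pchar R].-nat Q ->
  exists phi : {rmorphism R -> R}, forall x, phi x = x ^+ Q.
Proof.
move=> chQ; have Q_gt0 : (0 < Q)%N by case/andP: chQ.
have morphB : zmod_morphism (fun x : R => x ^+ Q).
  by move=> x y; apply: (addIr (y ^+ Q)); rewrite -exprDn_pchar // !subrK.
have morphM : monoid_morphism (fun x : R => x ^+ Q).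
  by split=> [|x y]; rewrite ?expr1n ?exprMn.
pose A := GRing.isZmodMorphism.Build R R _ morphB.
pose B := GRing.isMonoidMorphism.Build R R _ morphM.
pose phi : {rmorphism R -> R} := HB.pack (fun x : R => x ^+ Q) A B.
by exists phi.
Qed.

(** * Character sums of rational functions *)

Section Weil.
Variables (F : finFieldType) (K : closedFieldType) (iota : {rmorphism F -> K}).
Variable phi : {rmorphism K -> K}.
Local Notation Q := #|F|.
Hypotheses (phiE : forall x, phi x = x ^+ Q) (chQ : [pchar K].-nat Q).
Local Notation "p ^i" := (map_poly iota p) (at level 2, format "p ^i").
Local Notation cyc := (cyc iota phi).
Local Notation fixpts := (fixpts F K).

(* The resultant of g and the monic polynomial with roots r; it lies in F when r is
   stable under phi. *)
Definition resF (r : seq K) (g : {poly F}) : F := iinv iota (\prod_(u <- r) g^i.[u]).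

Section Resultant.
Variable r : seq K.
Hypothesis perm_r : perm_eq (map phi r) r.

Lemma resF_E g : iota (resF r g) = \prod_(u <- r) g^i.[u].
Proof.
apply: (iinvE iota phiE); rewrite rmorph_prod -[RHS](perm_big _ perm_r) big_map.
by apply: eq_bigr => u _; rewrite -{2}(map_phi_iota iota phiE g) horner_map.
Qed.

Lemma resFM g h : resF r (g * h) = resF r g * resF r h.
Proof.
apply: (fmorph_inj iota); rewrite rmorphM /= !resF_E -big_split.
by apply: eq_bigr => u _; rewrite rmorphM hornerM.
Qed.

Lemma resF1 : resF r 1 = 1.
Proof. by rewrite /resF rmorph1 big1 ?iinvK => [|u _]; rewrite ?hornerC // -(rmorph1 iota) iinvK. Qed.

Lemma resF_mod (W g : {poly F}) : (forall u, u \in r -> root W^i u) ->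
  resF r (g %% W) = resF r g.
Proof.
move=> rootW; rewrite /resF; congr iinv; apply: eq_big_seq => u /rootW Wu.
by rewrite [in RHS](divp_eq g W) rmorphD rmorphM hornerD hornerM /= (rootP Wu) mulr0 add0r.
Qed.

(** The sign is chosen so that the value at x is the product over r of the values of X - x. *)
Definition revprod : {poly K} := \prod_(u <- r) (u%:P - 'X).

Lemma revprod_E x : revprod.[x] = \prod_(u <- r) (u - x).
Proof. by rewrite horner_prod; apply: eq_bigr => u _; rewrite !hornerE. Qed.

Lemma revprod_phi x : revprod.[phi x] = phi revprod.[x].
Proof.
rewrite !revprod_E rmorph_prod -(perm_big _ perm_r) big_map.
by apply: eq_bigr => u _; rewrite rmorphB.
Qed.

Lemma revprod_eq0 x : (revprod.[x] == 0) = (x \in r).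
Proof.
rewrite revprod_E prodf_seq_eq0 /=; apply/hasP/idP => [[u ru]|xr].
  by rewrite subr_eq0 => /eqP <-.
by exists x => //; rewrite subrr.
Qed.

(** The resultant with the orbit polynomial of x is the product of the conjugates of [revprod.[x]],
    that is, its norm, and the l-th conjugate is its Q^l-th power. *)
Lemma resF_cyc i x : iter i phi x = x ->
  iota (resF r (cyc i x)) = revprod.[x] ^+ (\sum_(l < i) Q ^ l).
Proof.
move=> fix_x; rewrite resF_E (cycE iota phiE fix_x) /orbit_poly.
under eq_bigr => u _ do rewrite horner_prod.
rewrite exchange_big /= expr_sum; apply: eq_bigr => l _.
rewrite -(iter_phi phiE) (_ : iter l phi revprod.[x] = revprod.[iter l phi x]); last first.
  by elim: (val l) => //= j ->; rewrite revprod_phi.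
by rewrite revprod_E; apply: eq_bigr => u _; rewrite !hornerE.
Qed.

Lemma revprod_scale : revprod = (-1) ^+ size r *: \prod_(u <- r) ('X - u%:P).
Proof.
rewrite /revprod; elim: (r) => [|u s IH]; first by rewrite !big_nil expr0 scale1r.
rewrite !big_cons IH exprS -opprB -scalerA -scaleN1r.
by rewrite -scalerAl -scalerAr.
Qed.
End Resultant.

Lemma map_roots_perm (A : {poly F}) (r : seq K) :
  A != 0 -> A^i = lead_coef A^i *: \prod_(u <- r) ('X - u%:P) -> perm_eq (map phi r) r.
Proof.
move=> nz_A defA; have nz_c : lead_coef A^i != 0 by rewrite lead_coef_eq0 map_poly_eq0.
apply: prod_XsubC_eq; apply: (scalerI nz_c); rewrite -defA.
rewrite -[RHS](map_phi_iota iota phiE) [in RHS]defA map_polyZ /= rmorph_prod.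
rewrite lead_coef_map /= (phi_iota iota phiE) big_map; congr (_ *: _).
by apply: eq_bigr => u _; rewrite rmorphB /= map_polyX map_polyC.
Qed.
End Weil.

(** * Weil's bound for quotients of resultants *)

Section WeilSum.
Variables (F : finFieldType) (K : closedFieldType) (iota : {rmorphism F -> K}).
Variable phi : {rmorphism K -> K}.
Local Notation Q := #|F|.
Hypotheses (phiE : forall x, phi x = x ^+ Q) (chQ : [pchar K].-nat Q).
Local Notation "p ^i" := (map_poly iota p) (at level 2, format "p ^i").
Local Notation cyc := (cyc iota phi).
Local Notation fixpts := (fixpts F K).

Variables (z : F) (m : nat).
Hypotheses (prim_z : (Q.-1).-primitive_root z) (m_dvd : (m %| Q.-1)%N).

Variables (rA rB : seq K) (x0 : K) (mu : nat) (B' : {poly K}).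
Hypotheses (permA : perm_eq (map phi rA) rA) (permB : perm_eq (map phi rB) rB).
Hypotheses (defB : revprod rB = ('X - x0%:P) ^+ mu * B') (B'x0 : B'.[x0] != 0).
Hypotheses (x0A : x0 \notin rA) (co_mu : coprime m mu).

(** When rA and rB are the roots of A and B, the value at X - y is A(y) / B(y) up to a constant
    factor. *)
Definition resQ (g : {poly F}) : F := resF iota rA g / resF iota rB g.

Let m_pos : (0 < m)%N := exponent_gt0 prim_z m_dvd.

Lemma resQ_cyc_eq0 i x : iter i.+1 phi x = x -> (resQ (cyc i.+1 x) == 0) = (x \in rA ++ rB).
Proof.
move=> fix_x; rewrite /resQ mulf_eq0 invr_eq0 mem_cat -!(fmorph_eq0 iota).
rewrite !(resF_cyc iota phiE) // !expf_eq0 !revprod_eq0.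
by rewrite big_ord_recl.
Qed.

Lemma size_revprod r : (size (revprod r : {poly K}) <= (size r).+1)%N.
Proof.
rewrite revprod_scale; apply: leq_trans (size_scale_leq _ _) _.
by rewrite size_prod_XsubC.
Qed.

Definition in_class i j x :=
  (resQ (cyc i x) != 0) && (dlog z (resQ (cyc i x)) %% m == j)%N.

(** Let M = Q^(i+1) and let R be [revprod rA] over [revprod rB]. The points of the extension of
    degree 2 (i+1) satisfy x^(M^2) = x, and x lies in class j only if the norm of R(x), raised to
    the power (Q-1)/m, is zeta. This prescribes R(x)^(n0 (M+1)), so [stepanov_bound] applies. *)
Lemma class_bound : exists C i0, forall i, (i0 <= i)%N -> forall j,
  (m * count (in_class (2 * i.+1) j) (fixpts (2 * i.+1))
   <= Q ^ i.+1 * Q ^ i.+1 + C * Q ^ i.+1)%N.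
Proof.
have [C [M0 step]] := stepanov_bound (maxn (size rA) (size rB)) m_pos co_mu.
exists C, M0 => i le_i j; rewrite -size_filter.
have dvd_M : (m %| (Q ^ i.+1).-1)%N.
  by rewrite predn_exp dvdn_mulr.
pose n0 := ((Q ^ i.+1).-1 %/ m)%N.
have M_E : (Q ^ i.+1)%N = (m * n0).+1.
  by rewrite mulnC divnK // prednK // expn_gt0 (ltnW (Q_gt1 F)).
have E2 : (2 * i.+1 = (2 * i).+2)%N by rewrite mulnS.
pose zeta : K := iota (z ^+ (j * (Q.-1 %/ m))).
apply: (step K _ n0 (revprod rA) B' x0 zeta) => //.
- by rewrite pnatX chQ.
- by apply: leq_trans (ltnW (ltn_expl _ (Q_gt1 F))); rewrite leqW.
- by rewrite revprod_eq0.
- by apply: leq_trans (size_revprod _) _; rewrite ltnS leq_maxl.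
- by rewrite -defB; apply: leq_trans (size_revprod _) _; rewrite ltnS leq_maxr.
- by rewrite filter_uniq // E2 uniq_fixpts.
move=> x; rewrite mem_filter => /andP[/andP[nz_res /eqP dlog_j]].
rewrite E2 (mem_fixpts phiE) -E2 => /eqP fix_x.
have := nz_res; rewrite E2 resQ_cyc_eq0 -?E2 // mem_cat negb_or => /andP[xA xB].
rewrite -expnD addnn -mul2n; split.
- by rewrite -(iter_phi phiE).
- by rewrite revprod_eq0.
have bx : (revprod rB).[x] != 0 by rewrite revprod_eq0.
rewrite -defB; apply: (mulIf (expf_neq0 (n0 * (Q ^ i.+1).+1) (invr_neq0 bx))).
rewrite -!mulrA -!exprMn mulfV // expr1n mulr1.
have <- : ((\sum_(l < 2 * i.+1) Q ^ l) * (Q.-1 %/ m) = n0 * (Q ^ i.+1).+1)%N.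
  apply/eqP; rewrite -(eqn_pmul2r m_pos) -mulnA divnK // mulnC -predn_exp.
  rewrite mul2n -addnn expnD; move: (Q ^ i.+1)%N M_E => M ->.
  by rewrite mulnAC [(n0 * m)%N]mulnC mulSn [in X in _ == X]mulnS.
rewrite exprM exprMn exprVn -!(resF_cyc iota phiE) // -fmorphV -rmorphM /= -rmorphXn /zeta /=.
congr (iota _); rewrite -/(resQ _) -{1}(dlogK prim_z nz_res) -exprM.
apply/eqP; rewrite (eq_prim_root_expr prim_z) -dlog_j; move: (dlog z _) => d.
by rewrite {1}(divn_eq d m) mulnDl -mulnA [(m * _)%N]mulnC divnK // modnMDl.
Qed.

Lemma count_regular i :
  (Q ^ i.+1 <= count (fun x => resQ (cyc i.+1 x) != 0%R) (fixpts i.+1) + size (rA ++ rB))%N.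
Proof.
rewrite -(size_fixpts F K i) -(count_predC (fun x => resQ (cyc i.+1 x) != 0)) leq_add2l.
rewrite -size_filter uniq_leq_size ?filter_uniq ?uniq_fixpts // => x.
rewrite mem_filter (mem_fixpts phiE) /= negbK => /andP[+ /eqP fix_x].
by rewrite resQ_cyc_eq0.
Qed.

Variable w : algC.
Hypotheses (wm : w ^+ m = 1) (w_neq1 : w != 1).

Definition Xchar (g : {poly F}) : algC := chi z w (resQ g).

(** Upper bounds on the classes suffice. As sum_j w^j = 0, m S = - sum_j w^j (U - m N_j) with U =
    M^2 + C M. The deficits U - m N_j are nonnegative, and their sum is O(M) because the classes
    together contain all but boundedly many of the M^2 points. *)
Lemma charsum_bound : exists C i0, forall i, (i0 <= i)%N ->
  `|Ssum Xchar iota phi (2 * i.+1)| <= C%:R * (Q ^ i.+1)%:R.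
Proof.
have [C [i0 bound]] := class_bound; exists (C + size (rA ++ rB))%N, i0 => i le_i.
set n := (2 * i.+1)%N; set M := (Q ^ i.+1)%N; pose N j := count (in_class n j) (fixpts n).
have sumS : Ssum Xchar iota phi n = \sum_(j < m) w ^+ j *+ N j.
  transitivity (\sum_(x <- fixpts n) \sum_(j < m) w ^+ j *+ in_class n j x).
    apply: eq_bigr => x _; rewrite /Xchar /chi /in_class; case: eqP => _.
      by rewrite big1.
    pose j0 := Ordinal (ltn_pmod (dlog z (resQ (cyc n x))) m_pos).
    rewrite (bigD1 j0) //= eqxx big1 ?addr0 ?(exp_dlog _ wm) //.
    by move=> j /negPf jj0; rewrite eq_sym -[_ == _]/(j == j0) jj0.
  rewrite exchange_big; apply: eq_bigr => j _; rewrite sumrMnr; congr (_ *+ _).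
  by rewrite /N -sum1_count [RHS]big_mkcond; apply: eq_bigr => x _; case: in_class.
have sum_w : \sum_(j < m) w ^+ j = 0.
  have /eqP := subrX1 w m; rewrite wm subrr eq_sym mulf_eq0 subr_eq0 (negPf w_neq1).
  by move/eqP.
have sumN : (M * M <= \sum_(j < m) N j + size (rA ++ rB))%N.
  have -> : (M * M = Q ^ n)%N by rewrite -expnD addnn -mul2n.
  have := count_regular (2 * i).+1; rewrite (_ : (2 * i).+2 = n)%N; last by rewrite /n mulnS.
  move/leq_trans; apply; rewrite leq_add2r.
  rewrite -sum1_count big_mkcond (eq_bigr _ (fun j _ => esym (sum1_count _ _))).
  under [leqRHS]eq_bigr => j _ do rewrite big_mkcond.
  rewrite exchange_big leq_sum //= => x _; case: ifP => // nz_x.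
  pose j0 := Ordinal (ltn_pmod (dlog z (resQ (cyc n x))) m_pos).
  by rewrite (bigD1 j0) //= /in_class nz_x eqxx.
pose U := (M * M + C * M)%N.
have le_U j : (m * N j <= U)%N by rewrite bound.
have norm_w : `|w| = 1 by apply/eqP; rewrite -(pexpr_eq1 m_pos) // -normrX wm normr1.
have mS : m%:R * Ssum Xchar iota phi n = - \sum_(j < m) w ^+ j *+ (U - m * N j).
  under [in RHS]eq_bigr => j _ do rewrite mulrnBr //.
  rewrite sumrB sumrMnl sum_w mul0rn sub0r opprK sumS big_distrr.
  by apply: eq_bigr => j _ /=; rewrite mulr_natl -mulrnA mulnC.
have m_gt0 : 0 < m%:R :> algC by rewrite ltr0n.
rewrite -(ler_pM2l m_gt0) -{1}normr_nat -normrM mS normrN.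
apply: le_trans (ler_norm_sum _ _ _) _.
under eq_bigr => j _ do rewrite normrMn normrX norm_w expr1n.
rewrite -natr_sum -!natrM ler_nat sumnB // -big_distrr /= sum_nat_const card_ord -mulnBr.
rewrite leq_mul2l /U; apply/orP; right; rewrite mulnDl.
have : (size (rA ++ rB) <= size (rA ++ rB) * M)%N.
  by rewrite leq_pmulr // expn_gt0 (ltnW (Q_gt1 F)).
by move: sumN; move: (\sum_(j < m) N j)%N (M * M)%N (size (rA ++ rB)) (C * M)%N (_ * M)%N => *; lia.
Qed.

Variable W : {poly F}.
Hypotheses (nz_W : W != 0) (rootW : forall u, root W^i u = (u \in rA ++ rB)).

Lemma XcharM g h : Xchar (g * h) = Xchar g * Xchar h.
Proof.
rewrite /Xchar /resQ (resFM iota phiE permA) (resFM iota phiE permB) invfM mulrACA.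
exact: (chiM prim_z m_dvd wm).
Qed.

Lemma Xchar1 : Xchar 1 = 1.
Proof. by rewrite /Xchar /resQ !resF1 divr1 (chi1 prim_z m_dvd wm). Qed.

Lemma Xchar_mod g : Xchar (g %% W) = Xchar g.
Proof.
by rewrite /Xchar /resQ !(resF_mod (W := W)) // => u ru; rewrite rootW mem_cat ru ?orbT.
Qed.

Lemma cyc_coprime i x : iter i.+1 phi x = x -> resQ (cyc i.+1 x) != 0 -> coprimep W (cyc i.+1 x).
Proof.
move=> fix_x nz_x; rewrite -(coprimep_map iota).
apply/Pdiv.ClosedField.coprimepP => u; rewrite rootW mem_cat => ru.
apply: contraNneq nz_x => cu; rewrite /resQ mulf_eq0 invr_eq0 -!(fmorph_eq0 iota).
rewrite (resF_E iota phiE permA) (resF_E iota phiE permB) !prodf_seq_eq0.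
by apply/orP; case/orP: ru => ru; [left|right]; apply/hasP; exists u; rewrite // cu eqxx.
Qed.

(* If X were trivial, the character sums would be too large for charsum_bound. *)
Lemma Xchar_nontrivial : exists2 g0, coprimep W g0 & Xchar g0 != 1.
Proof.
have [|/existsPn triv] := boolP [exists v : 'rV[F]_(size W),
    coprimep W (rVpoly v) && (Xchar (rVpoly v) != 1)].
  by case/existsP => v /andP[co_v Xv]; exists (rVpoly v).
have {}triv g : coprimep W g -> Xchar g = 1.
  move=> co_g; have := triv (poly_rV (g %% W)).
  rewrite poly_rV_K; last by rewrite ltnW // ltn_modp.
  by rewrite coprimep_modr co_g Xchar_mod /= negbK => /eqP.
have [C [i0 bound]] := charsum_bound; pose D := size (rA ++ rB).
(* For M = Q^(i+1) > C + D, a trivial X would give M^2 - D <= C M, which is impossible. *)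
pose i := maxn i0 (C + D); have := bound i (leq_maxl _ _).
have -> : Ssum Xchar iota phi (2 * i.+1) =
    (count (fun x => resQ (cyc (2 * i.+1) x) != 0) (fixpts (2 * i.+1)))%:R.
  rewrite mulnS -sum1_count natr_sum [RHS]big_mkcond; apply: eq_big_seq => x.
  rewrite (mem_fixpts phiE) => /eqP fix_x; case: ifPn => [nz_x|].
    by rewrite triv // cyc_coprime.
  by rewrite negbK /Xchar /chi => ->.
rewrite normr_nat -natrM ler_nat => le_count.
have := count_regular (2 * i).+1; rewrite (_ : (2 * i).+2 = 2 * i.+1)%N; last by rewrite mulnS.
have -> : (Q ^ (2 * i.+1) = Q ^ i.+1 * Q ^ i.+1)%N by rewrite -expnD addnn -mul2n.
rewrite -/D => le_M.
have lt_M : (C + D < Q ^ i.+1)%N.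
  by apply: leq_trans (ltn_expl _ (Q_gt1 F)); rewrite ltnS leqW ?leq_maxr.
move: le_count le_M lt_M; move: (count _ _) (Q ^ i.+1)%N => c M le_c le_M lt_M.
have : ((C + D).+1 * M <= M * M)%N by rewrite leq_mul2r lt_M orbT.
have : (D <= D * M)%N by rewrite leq_pmulr //; lia.
by rewrite mulSn mulnDl; move: (M * M)%N (D * M)%N (C * M)%N le_M le_c => *; lia.
Qed.

Lemma fixpts1 : perm_eq (fixpts 1) [seq iota y | y : F].
Proof.
apply: uniq_perm; first exact: uniq_fixpts.
  by rewrite map_inj_uniq ?enum_uniq //; exact: fmorph_inj.
move=> x; rewrite (mem_fixpts phiE) /=; apply/eqP/mapP => [fix_x|[y _ ->]].
  by exists (iinv iota x); rewrite ?mem_enum // (iinvE iota phiE).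
exact: (phi_iota iota phiE).
Qed.

Lemma cyc1 y : cyc 1 (iota y) = 'X - y%:P.
Proof.
apply: (@map_poly_inj _ _ iota); rewrite (cycE iota phiE); last exact: (phi_iota iota phiE).
by rewrite /orbit_poly big_ord1 rmorphB /= map_polyX map_polyC.
Qed.

(** The sum is S_1. The e_k vanish from k = deg W on, so there are at most deg W - 1 reciprocal
    roots, each of absolute value at most sqrt Q. *)
Lemma weil_Xchar : `|\sum_(y : F) Xchar ('X - y%:P)| <= ((size W).-2)%:R * sqrtC Q%:R.
Proof.
have -> : \sum_(y : F) Xchar ('X - y%:P) = Ssum Xchar iota phi 1.
  rewrite /Ssum (perm_big _ fixpts1) big_map big_enum.
  by apply: eq_bigr => y _; rewrite cyc1.
have [g0 co_g0 Xg0] := Xchar_nontrivial; have [C [i0 bound]] := charsum_bound.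
apply: (trace_bound (e := Lcoef Xchar) (C := C%:R) (i0 := i0.+1)).
- by rewrite ltr0n (ltnW (Q_gt1 F)).
- exact: Lcoef0 Xchar1.
- move=> k lt_k; apply: (Lcoef_eq0 XcharM Xchar_mod nz_W co_g0 Xg0).
  by move: lt_k; case: (size W) => [|[]].
- exact: newton_Lcoef XcharM _ _ _ phiE chQ.
by case=> // i le_i; rewrite -natrX; apply: bound.
Qed.
End WeilSum.

(** * Weil's bound for A / B and its m-th power values *)

Section WeilBound.
Variables (F : finFieldType) (K : closedFieldType) (iota : {rmorphism F -> K}).
Local Notation Q := #|F|.
Hypothesis chQ : [pchar K].-nat Q.
Local Notation "p ^i" := (map_poly iota p) (at level 2, format "p ^i").
Variables (A B W : {poly F}) (x0 : K) (mu : nat) (B' : {poly K}).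
Hypotheses (nz_A : A != 0) (nz_B : B != 0) (nz_W : W != 0).
Hypothesis rootW : forall u, root W^i u = root A^i u || root B^i u.
Hypotheses (defB : B^i = ('X - x0%:P) ^+ mu * B') (B'x0 : B'.[x0] != 0).
Hypothesis Ax0 : ~~ root A^i x0.
Variables (z : F) (m : nat).
Hypotheses (prim_z : (Q.-1).-primitive_root z) (m_dvd : (m %| Q.-1)%N) (co_mu : coprime m mu).

(** A(y) / B(y) is k times the quotient of resultants at X - y, and chi(k) has absolute value 1.
    Since W is any nonzero polynomial with the roots of A B, multiplicities in A B do not enlarge
    the bound. *)
Lemma weil_bound (w : algC) : w ^+ m = 1 -> w != 1 ->
  `|\sum_(y : F) chi z w (A.[y] / B.[y])| <= ((size W).-2)%:R * sqrtC Q%:R.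
Proof.
move=> wm w_neq1; have [phi phiE] := frobenius_rmorphism chQ.
have [rA defA] := closed_field_poly_normal A^i.
have [rB defBr] := closed_field_poly_normal B^i.
have permA := map_roots_perm phiE nz_A defA.
have permB := map_roots_perm phiE nz_B defBr.
have lcB : lead_coef B^i != 0 by rewrite lead_coef_eq0 map_poly_eq0.
have lcA : lead_coef A^i != 0 by rewrite lead_coef_eq0 map_poly_eq0.
have memA u : (u \in rA) = root A^i u by rewrite defA rootZ // root_prod_XsubC.
have memB u : (u \in rB) = root B^i u by rewrite defBr rootZ // root_prod_XsubC.
pose c := (-1) ^+ size rB / lead_coef B^i.
have nz_c : c != 0 by rewrite mulf_neq0 ?invr_eq0 // signr_eq0.
have revB : revprod rB = ('X - x0%:P) ^+ mu * (c *: B').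
  by rewrite -scalerAr -defB revprod_scale [in RHS]defBr scalerA /c divfK.
have eval_res (D : {poly F}) r : perm_eq (map phi r) r ->
    D^i = lead_coef D^i *: \prod_(u <- r) ('X - u%:P) ->
    forall y, D.[y] = (lead_coef D * (-1) ^+ size r) * resF iota r ('X - y%:P).
  move=> perm_r defD y; apply: (fmorph_inj iota).
  rewrite !rmorphM rmorphXn rmorphN1 (resF_E iota phiE perm_r) -horner_map /= defD.
  rewrite lead_coef_map -mulrA hornerZ; congr (_ * _).
  transitivity ((-1) ^+ size r * (revprod r).[iota y]).
    by rewrite revprod_scale hornerZ mulrA -exprMn mulN1r opprK expr1n mul1r.
  rewrite revprod_E; congr (_ * _); apply: eq_bigr => u _.
  by rewrite rmorphB /= map_polyX map_polyC !hornerE.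
pose k := (lead_coef A * (-1) ^+ size rA) / (lead_coef B * (-1) ^+ size rB).
have nz_k : k != 0 by rewrite !mulf_neq0 ?invr_eq0 ?mulf_neq0 ?lead_coef_eq0 ?signr_eq0.
have -> : \sum_(y : F) chi z w (A.[y] / B.[y]) =
    chi z w k * \sum_(y : F) Xchar iota z rA rB w ('X - y%:P).
  rewrite big_distrr; apply: eq_bigr => y _ /=.
  rewrite -(chiM prim_z m_dvd wm); congr chi.
  by rewrite (eval_res A rA permA defA) (eval_res B rB permB defBr) /k /resQ invfM mulrACA.
rewrite normrM (norm_chi prim_z m_dvd wm nz_k) mul1r.
apply: (weil_Xchar phiE chQ prim_z m_dvd permA permB revB) => //.
- by rewrite hornerZ mulf_neq0.
- by rewrite memA.
- by move=> u; rewrite rootW mem_cat memA memB.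
Qed.

Hypothesis small : ((m * (size W).-1) ^ 2 <= Q)%N.

(** Otherwise the sum over t < m of the characters chi^t vanishes at every y. Summed over y, the
    term t = 0 counts at least Q - deg W points, and the other m - 1 terms are too small by Weil's
    bound to cancel it. *)
Lemma exists_kummer_value : exists y, (A.[y] / B.[y] != 0) && (m %| dlog z (A.[y] / B.[y]))%N.
Proof.
apply/existsP; apply: contraT => /existsPn none.
have m_pos := exponent_gt0 prim_z m_dvd.
have [w prim_w] := C_prim_root_exists m_pos.
pose R y := A.[y] / B.[y].
have orth y : \sum_(t < m) chi z (w ^+ t) (R y) = 0.
  rewrite /chi; have [_|nz_R] := eqVneq (R y) 0; first by rewrite big1.
  have := none y; rewrite -/(R y) nz_R /= => ndvd.
  have := subrX1 (w ^+ dlog z (R y)) m.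
  rewrite -exprM mulnC exprM (prim_expr_order prim_w) expr1n subrr => /esym/eqP.
  rewrite mulf_eq0 subr_eq0 -(prim_order_dvd prim_w) (negPf ndvd) => /eqP E; rewrite -[RHS]E.
  by apply: eq_bigr => t _; rewrite -!exprM mulnC.
have reg : (Q <= #|[set y | (R y != 0)%R]| + (size W).-1)%N.
  rewrite -(cardsC [set y | R y != 0]) leq_add2l cardE.
  rewrite -ltnS (prednK (_ : 0 < size W)%N) ?size_poly_gt0 //.
  apply: max_poly_roots; rewrite ?enum_uniq //; apply/allP => y.
  rewrite mem_enum !inE negbK /R mulf_eq0 invr_eq0 => ABy.
  by rewrite -(fmorph_root iota) rootW !fmorph_root.
pose s : algC := sqrtC Q%:R; set S := (size W).-1 in reg.
have smallS : ((m * S) ^ 2 <= Q)%N := small.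
have s2 : s ^+ 2 = Q%:R by rewrite sqrtCK.
have s_ge0 : 0 <= s by rewrite sqrtC_ge0 ler0n.
have reg_le : (#|[set y | R y != 0]|%:R : algC) <= (m.-1 * S.-1)%:R * s.
  have : \sum_(y : F) \sum_(t < m) chi z (w ^+ t) (R y) = 0 by rewrite big1.
  rewrite exchange_big /= -(prednK m_pos) big_ord_recl /= expr0 => /eqP.
  have -> : \sum_(y : F) chi z 1 (R y) = #|[set y | R y != 0]|%:R.
    rewrite -sum1_card natr_sum [RHS]big_mkcond; apply: eq_bigr => y _.
    by rewrite inE /chi expr1n; case: eqP.
  rewrite addr_eq0 => /eqP E; rewrite -[leLHS]normr_nat {}E normrN.
  apply: le_trans (ler_norm_sum _ _ _) _; rewrite natrM -mulrA mulr_natl.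
  rewrite -[X in _ *+ X](card_ord m.-1) -sumr_const; apply: ler_sum => t _.
  apply: weil_bound; first by rewrite exprAC (prim_expr_order prim_w) expr1n.
  rewrite -(prim_order_dvd prim_w) /bump add1n gtnNdvd // -[X in (_ < X)%N](prednK m_pos).
  by rewrite ltnS ltn_ord.
have le_mS : ((m * S)%:R : algC) <= s.
  rewrite -(@ler_pXn2r _ 2) ?nnegrE ?ler0n //.
  by rewrite s2 -natrX ler_nat.
have : (Q%:R : algC) <= (m.-1 * S.-1)%:R * s + S%:R.
  by move: reg; rewrite -(ler_nat algC) natrD => /le_trans; apply; rewrite lerD2r.
have s_gt1 : 1 < s.
  by rewrite -(@ltr_pXn2r _ 2) ?nnegrE ?ler01 // expr1n s2 ltr1n finNzRing_gt1.
suff /lt_geF-> : (m.-1 * S.-1)%:R * s + S%:R < Q%:R by [].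
have s_gt0 : 0 < s := lt_trans ltr01 s_gt1.
(* For S > 0: (m-1)(S-1) s + S < (m-1) S s + S s = m S s <= s^2, using s > 1 and m S <= s. *)
rewrite -s2 expr2; have [->|S_gt0] := posnP S.
  by rewrite muln0 mul0r add0r mulr_gt0.
apply: le_lt_trans (_ : (m.-1 * S)%:R * s + S%:R < _).
  by rewrite lerD2r ler_wpM2r // ler_nat leq_mul2l leq_pred orbT.
apply: lt_le_trans (_ : (m.-1 * S)%:R * s + S%:R * s <= _).
  by rewrite ltrD2l -[ltLHS]mulr1 ltr_pM2l // ltr0n.
by rewrite -mulrDl -natrD -mulSnr prednK // ler_wpM2r.
Qed.
End WeilBound.

(** * Linearized polynomials *)

Section LinearizedPolynomials.
Variables (F : finFieldType) (q n : nat).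
Hypotheses (q_gt1 : (1 < q)%N) (cardF : #|F| = (q ^ n)%N) (chq : [pchar F].-nat q).

Definition linpoly (c : nat -> F) d : {poly F} := \sum_(i < d.+1) c i *: 'X^(q ^ i).

Lemma horner_linpoly c d y : (linpoly c d).[y] = linq_f q d c y.
Proof. by rewrite horner_sum; apply: eq_bigr => i _; rewrite !hornerE. Qed.

Lemma size_linpoly c d : (size (linpoly c d) <= (q ^ d).+1)%N.
Proof.
apply: leq_trans (size_sum _ _ _) _; apply/bigmax_leqP => i _.
apply: leq_trans (size_scale_leq _ _) _; rewrite size_polyXn ltnS.
by rewrite leq_exp2l // -ltnS ltn_ord.
Qed.

Lemma coef_linpoly c d i : (i <= d)%N -> (linpoly c d)`_(q ^ i) = c i.
Proof.
rewrite -ltnS => lt_i; rewrite coef_sum (bigD1 (Ordinal lt_i)) //= big1 => [|j ji].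
  by rewrite coefZ coefXn eqxx mulr1 addr0.
rewrite coefZ coefXn eqn_exp2l // (_ : (i == j) = false) ?mulr0 //.
by rewrite eq_sym; exact: negPf.
Qed.

(** F is perfect: since x^(q^n) = x, the power q^(n j - j) extracts q^j-th roots of the
    coefficients. *)
Lemma linpoly_eq_exp c d j : (j <= d)%N -> (forall i, (i < j)%N -> c i = 0) ->
  exists2 c', linpoly c d = linpoly c' (d - j) ^+ (q ^ j) &
    forall i, c' i ^+ (q ^ j) = c (i + j)%N.
Proof.
move=> le_jd c0.
have n_gt0 : (0 < n)%N by have := finNzRing_gt1 F; rewrite cardF; case: (n).
have frob_root x : (x ^+ (q ^ (n * j - j))) ^+ (q ^ j) = x :> F.
  rewrite -exprM -expnD subnK ?leq_pmull // expnM -cardF.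
  by elim: (j) => [|l IH]; rewrite ?expn0 ?expr1 // expnSr exprM IH expf_card.
pose c' i := c (i + j)%N ^+ (q ^ (n * j - j)).
have c'E i : c' i ^+ (q ^ j) = c (i + j)%N by rewrite frob_root.
exists c' => //; rewrite /linpoly expr_sum_pchar; last first.
  by rewrite (eq_pnat _ (pchar_poly F)) pnatX chq.
rewrite -(big_mkord xpredT (fun i => c i *: 'X^(q ^ i))).
rewrite (big_cat_nat (n := j)) ?leqW //= big1_seq ?add0r => [|i]; last first.
  by rewrite mem_index_iota => /andP[_ /c0->]; rewrite scale0r.
rewrite -{1}[j]add0n big_addn subSn // big_mkord; apply: eq_bigr => i _.
by rewrite exprZn c'E -exprM expnD.
Qed.

Lemma deriv_linpoly c d : (linpoly c d)^`() = (c 0%N)%:P.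
Proof.
rewrite linear_sum big_ord_recl /= derivZ expn0 derivX alg_polyC big1 ?addr0 // => i _.
rewrite derivZ derivXn /bump add1n expnS -scaler_nat natrM (natr_pchar0 chq q_gt1).
by rewrite mul0r scale0r scaler0.
Qed.

(** The derivative is the nonzero constant c_0, so all roots are simple. There are q^d > 1 of them,
    so they are not all 0. *)
Lemma linpoly_simple_root (K : closedFieldType) (iota : {rmorphism F -> K}) c d :
  (0 < d)%N -> c 0%N != 0 -> c d != 0 ->
  exists x0 H, [/\ x0 != 0, map_poly iota (linpoly c d) = ('X - x0%:P) * H & H.[x0] != 0].
Proof.
move=> d_gt0 c0 cd; set P := map_poly iota _.
have derP : P^`() = (iota (c 0%N))%:P by rewrite /P deriv_map deriv_linpoly map_polyC.
have nz_c : iota (c 0%N) != 0 by rewrite fmorph_eq0.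
have [r defP] := closed_field_poly_normal P.
have nz_P : P != 0.
  by apply: contraNneq nz_c => P0; move: derP; rewrite P0 deriv0 => /esym/eqP; rewrite polyC_eq0.
have size_r : (1 < size r)%N.
  have lt_P : (q ^ d < size P)%N.
    rewrite size_map_poly ltnNge; apply: contra cd => /leq_sizeP/(_ _ (leqnn _)).
    by rewrite coef_linpoly // => ->.
  rewrite defP size_scale ?lead_coef_eq0 // size_prod_XsubC ltnS in lt_P.
  apply: leq_trans lt_P; apply: leq_trans q_gt1 _.
  by rewrite -{1}[q]expn1 leq_exp2l.
have [x0 rx0 nz_x0] : exists2 x0, x0 \in r & x0 != 0.
  have [/hasP //|] := boolP (has (fun x => x != 0) r); rewrite -all_predC => /allP all0.
  have all0' : all (pred1 0) r by apply/allP => x /all0; rewrite /= negbK.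
  case/negP: nz_c; have /(congr1 (fun f : {poly K} => f.[0])) := derP.
  rewrite hornerC => <-; rewrite defP (all_pred1P _ _ all0') big_nseq iter_mulr_1.
  rewrite subr0 derivZ derivXn hornerZ hornerMn hornerXn -subn1 -(subnKC size_r) /=.
  by rewrite exprS mul0r mul0rn mulr0.
have /factor_theorem[H PH] : root P x0 by rewrite defP rootZ ?lead_coef_eq0 // root_prod_XsubC.
exists x0, H; rewrite mulrC; split=> //.
have /(congr1 (fun f : {poly K} => f.[x0])) := derP.
rewrite PH derivM derivXsubC mulr1 hornerD hornerM !hornerE subrr mulr0 add0r.
by move=> ->.
Qed.
End LinearizedPolynomials.

(** * The parameters of f and the common point *)

Lemma ell_spec (F : fieldType) d (a : nat -> F) i : (i <= d)%N -> a i != 0 ->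
  [/\ (ell d a <= i)%N, a (ell d a) != 0 & forall j, (j < ell d a)%N -> a j = 0].
Proof.
move=> le_id nz_ai; pose p := fun i => a i != 0.
have has_p : has p (iota 0 d.+1) by apply/hasP; exists i; rewrite ?mem_iota.
have lt_ell : (ell d a < d.+1)%N by rewrite /ell -{2}(size_iota 0 d.+1) -has_find.
have below j : (j < ell d a)%N -> a j = 0.
  move=> lt_j; have := before_find 0%N lt_j; rewrite nth_iota ?add0n; last exact: ltn_trans lt_j lt_ell.
  by move/negbT; rewrite negbK => /eqP.
split=> //; first by rewrite leqNgt; apply: contra nz_ai => /below ->.
by have := nth_find 0%N has_p; rewrite nth_iota.
Qed.

(** With j the minimum, these bounds make f, and A when beta is nonzero, a q^j-th power. If beta a_h
    = 1 then a_h is nonzero, whence l <= h. *)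
Lemma minn_m_h_spec (F : fieldType) d h (a : nat -> F) beta :
  a d != 0 -> (ell d a < d)%N -> (h <= ell d a)%N ->
  (minn (m_h d h a beta) (ell d a) <= ell d a)%N /\
  (beta != 0 -> (minn (m_h d h a beta) (ell d a) <= h)%N).
Proof.
move=> nz_ad lt_d le_h; rewrite geq_minr; split=> // nz_beta.
rewrite /m_h (negPf nz_beta); case: eqP => [ah1|_]; last exact: geq_minl.
apply: leq_trans (geq_minr _ _) _.
have nz_ah : a h != 0 by apply: contra_eq_neq ah1 => ->; rewrite mulr0 eq_sym oner_neq0.
by have [] := ell_spec (leq_trans le_h (ltnW lt_d)) nz_ah.
Qed.

(** Bezout: u r = v (|F| - 1) + gcd, so the r-th power of z^(u c) is z^(c gcd) = x. *)
Lemma gcdn_power (F : finFieldType) (z : F) r x : (#|F|.-1).-primitive_root z ->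
  (0 < r)%N -> x != 0 -> (gcdn r #|F|.-1 %| dlog z x)%N -> exists2 y, y != 0 & y ^+ r = x.
Proof.
move=> prim_z r_gt0 nz_x /dvdnP[c Ec]; case: (egcdnP #|F|.-1 r_gt0) => u v Euv _.
have nz_z : z != 0.
  by apply: contraTneq (prim_order_gt0 prim_z) => z0; have := prim_expr_order prim_z;
     rewrite z0 expr0n; case: (#|F|.-1) => //= l /eqP; rewrite eq_sym oner_eq0.
exists (z ^+ (u * c)); first by rewrite expf_neq0.
rewrite -exprM -mulnA [(c * r)%N]mulnC mulnA Euv mulnDl exprD mulnAC mulnC exprM.
by rewrite (prim_expr_order prim_z) expr1n mul1r [(_ * c)%N]mulnC -Ec dlogK.
Qed.

Theorem theorem3p14 (F : finFieldType) (q n k d h : nat) (alpha beta : F)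
    (a : nat -> F) :
  prime_power q -> (2 <= n)%N -> #|F| = (q ^ n)%N ->
  (1 <= k)%N -> (k < n)%N -> alpha != 0 ->
  (d < n)%N -> a d != 0 -> (forall i, (d < i)%N -> a i = 0) ->
  (exists2 i, (i < d)%N & a i != 0) (* f is not a monomial *) ->
  (h <= ell d a)%N ->
  (2 * (k + d - minn (m_h d h a beta) (ell d a) + 1) <= n)%N ->
  Lg_meets_sigmaLf (gbin q k alpha beta) (linq_f q d a) q h.
Proof.
move=> [p [e [p_prime [e_gt0 q_E]]]] n_ge2 cardF k_gt0 _ nz_alpha _ nz_ad _ [i0 lt_i0 nz_ai0] le_h.
have q_gt1 : (1 < q)%N by rewrite q_E -{1}(expn0 p) ltn_exp2l // prime_gt1.
have chq : [pchar F].-nat q.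
  have chp : p \in [pchar F] by apply: (card_finPcharP (n := (e * n)%N)); rewrite // expnM -q_E.
  by rewrite q_E pnatX (eq_pnat _ (pcharf_eq chp)) pnat_id.
have [K [iota _]] := countable_algebraic_closure F.
have chK : [pchar K].-nat #|F| by rewrite (eq_pnat _ (fmorph_pchar iota)) cardF pnatX chq.
have [le_ell nz_ell below_ell] := ell_spec (ltnW lt_i0) nz_ai0.
have lt_ell : (ell d a < d)%N := leq_ltn_trans le_ell lt_i0.
have [] := minn_m_h_spec beta nz_ad lt_ell le_h.
move: (minn _ _) => j le_j le_jh le_n; have le_jd := leq_trans le_j (ltnW lt_ell).
pose f := linpoly q a d; pose A := 'X^(q ^ h) - beta *: f; pose B := alpha *: f.
have q_pos l : (0 < q ^ l)%N by rewrite expn_gt0 ltnW.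
have h_le_d : (h <= d)%N := leq_trans le_h (ltnW lt_ell).
have coef_f i : (i <= d)%N -> f`_(q ^ i) = a i by exact: coef_linpoly.
have nz_f : f != 0.
  by apply: contraNneq nz_ad => f0; rewrite -(coef_f d) // f0 coef0.
have nz_B : B != 0 by rewrite scaler_eq0 negb_or nz_alpha.
have nz_A : A != 0.
  have [beta0|nz_beta] := eqVneq beta 0.
    by rewrite /A beta0 scale0r subr0 monic_neq0 ?monicXn.
  apply: contraNneq nz_ad => A0; have /(congr1 (fun g : {poly F} => g`_(q ^ d))) := A0.
  rewrite coef0 coefB coefXn coefZ coef_f // eqn_exp2l //.
  rewrite gtn_eqF; last exact: leq_ltn_trans le_h lt_ell.
  by rewrite sub0r => /eqP; rewrite oppr_eq0 mulf_eq0 (negPf nz_beta).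
have below_j i : (i < j)%N -> a i = 0.
  by move=> lt_i; rewrite below_ell // (leq_trans lt_i).
(* Extracting the q^j-th root keeps the roots and lowers the degree to at most q^(d-j). *)
have radical c : linpoly q c d != 0 -> (forall i, (i < j)%N -> c i = 0) ->
    exists G : {poly F}, [/\ G != 0, (size G <= (q ^ (d - j)).+1)%N &
      forall u : K, root (map_poly iota G) u = root (map_poly iota (linpoly q c d)) u].
  move=> nz_c c0; have [c' Ec _] := linpoly_eq_exp cardF chq le_jd c0.
  exists (linpoly q c' (d - j)); split; last 2 first.
  - exact: size_linpoly.
  - by move=> u; rewrite Ec rmorphXn /= /root horner_exp expf_eq0 q_pos.
  by apply: contraNneq nz_c => G0; rewrite Ec G0 expr0n eqn0Ngt q_pos.
have [G [nz_G size_G root_G]] : exists G : {poly F}, [/\ G != 0,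
    (size G <= (q ^ (d - j)).+1)%N & forall u : K, root (map_poly iota G) u = root (map_poly iota A) u].
  have [beta0|nz_beta] := eqVneq beta 0.
    exists 'X; rewrite polyX_eq0 size_polyX ltnS q_pos; split=> // u.
    by rewrite /A beta0 scale0r subr0 map_polyXn map_polyX /root !hornerE expf_eq0 q_pos.
  pose c i := (i == h)%:R - beta * a i.
  have defA : A = linpoly q c d.
    rewrite /linpoly; under eq_bigr => i _ do rewrite scalerBl -scalerA.
    rewrite sumrB -scaler_sumr; congr (_ - _).
    have lt_h : (h < d.+1)%N by [].
    rewrite (bigD1 (Ordinal lt_h)) //= eqxx scale1r big1 ?addr0 // => i ih.
    by rewrite (_ : (i == h :> nat) = false) ?scale0r //; exact: negPf.
  rewrite defA; apply: radical => [|i lt_i]; first by rewrite -defA.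
  rewrite /c below_j // mulr0 subr0.
  by rewrite ltn_eqF // (leq_trans lt_i) ?le_jh.
have [H [nz_H size_H root_H]] : exists H : {poly F}, [/\ H != 0,
    (size H <= (q ^ (d - j)).+1)%N & forall u : K, root (map_poly iota H) u = root (map_poly iota B) u].
  have [H [nz_H size_H root_H]] := radical a nz_f below_j.
  exists H; split=> // u.
  by rewrite root_H /B map_polyZ rootZ // fmorph_eq0.
pose W := G * H; have nz_W : W != 0 by rewrite mulf_neq0.
have size_W : ((size W).-1 <= 2 * q ^ (d - j))%N.
  rewrite size_mul // mul2n -addnn; have := leq_add size_G size_H.
  by rewrite addSn addnS; case: (size G + size H)%N => [|[|s]].
have rootW u : root (map_poly iota W) u = root (map_poly iota A) u || root (map_poly iota B) u.
  by rewrite rmorphM rootM root_G root_H.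
(* f is the q^l-th power of a polynomial with nonzero linear coefficient and degree q^(d-l) > 1, f
   not being a monomial. A nonzero simple root x0 of the latter has multiplicity q^l in f, and A(x0)
   = x0^(q^h) is nonzero. *)
have [c' Ef c'E] := linpoly_eq_exp cardF chq (ltnW lt_ell) below_ell.
have c'0 i : a (i + ell d a)%N != 0 -> c' i != 0.
  by rewrite -c'E; apply: contraNneq => ->; rewrite expr0n eqn0Ngt q_pos.
have [||| x0 [P [nz_x0 defP Px0]]] := @linpoly_simple_root F q q_gt1 chq K iota c' (d - ell d a).
- by rewrite subn_gt0.
- exact: c'0.
- by apply: c'0; rewrite subnK // ltnW.
have defB : map_poly iota B =
    ('X - x0%:P) ^+ (q ^ ell d a) * (iota alpha *: P ^+ (q ^ ell d a)).
  by rewrite /B /f Ef map_polyZ rmorphXn /= defP exprMn scalerAr.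
have fx0 : root (map_poly iota f) x0.
  by rewrite /f Ef rmorphXn /= defP exprMn rootM /root horner_exp hornerXsubC subrr expr0n eqn0Ngt q_pos eqxx.
have Ax0 : ~~ root (map_poly iota A) x0.
  rewrite /A rmorphB /= map_polyZ /= map_polyXn /root !hornerE (rootP fx0) mulr0 subr0.
  by rewrite expf_neq0.
have r_gt0 : (0 < (q ^ k).-1)%N.
  by rewrite -ltnS prednK // -{1}(expn0 q) ltn_exp2l.
pose m := gcdn (q ^ k).-1 #|F|.-1.
have co_m : coprime m (q ^ ell d a).
  apply: coprime_dvdl (dvdn_gcdl _ _) _; rewrite coprimeXr //.
  by apply: coprime_dvdr (dvdn_exp k_gt0 (dvdnn q)) _; rewrite coprime_sym coprimenP.
(* m deg W <= q^k 2 q^(d-j) <= q^(k+d-j+1), as 2 <= q, and the hypothesis on n bounds the square by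
   q^n. *)
have small : ((m * (size W).-1) ^ 2 <= #|F|)%N.
  have le_m : (m <= q ^ k)%N by rewrite (leq_trans (dvdn_leq r_gt0 (dvdn_gcdl _ _))) // leq_pred.
  apply: (@leq_trans ((q ^ k * (q * q ^ (d - j))) ^ 2)).
    rewrite leq_exp2r //; apply: leq_mul => //; apply: leq_trans size_W _.
    by rewrite leq_mul2r q_gt1 orbT.
  by rewrite -expnS -expnD -expnM cardF leq_exp2l // mulnC addnS addnBA // -[(_ - _).+1]addn1.
have [z prim_z] := finField_generator F.
have Bx0 : (iota alpha *: P ^+ (q ^ ell d a)).[x0] != 0.
  by rewrite hornerZ horner_exp mulf_neq0 ?expf_neq0 // fmorph_eq0.
have [y /andP[nz_R dvd_R]] := exists_kummer_value chK nz_A nz_B nz_W rootW defB Bx0 Ax0 prim_z (dvdn_gcdr _ _) co_m small.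
have [x nz_x Ex] := gcdn_power prim_z r_gt0 nz_R dvd_R.
have AyE : A.[y] = y ^+ (q ^ h) - beta * linq_f q d a y.
  by rewrite !hornerE horner_linpoly.
have ByE : B.[y] = alpha * linq_f q d a y by rewrite hornerZ horner_linpoly.
have [nz_Ay nz_By] : A.[y] != 0 /\ B.[y] != 0.
  by move: nz_R; rewrite mulf_eq0 invr_eq0 negb_or => /andP.
have nz_fy : linq_f q d a y != 0.
  by apply: contraNneq nz_By => f0; rewrite ByE f0 mulr0.
have nz_y : y != 0.
  apply: contraNneq nz_fy => ->; rewrite /linq_f big1 // => i _.
  by rewrite expr0n eqn0Ngt q_pos mulr0.
(* With lambda = x / f(y), the second coordinate requires alpha x^(q^k) + beta x = x y^(q^h) / f(y),
   which is x^(q^k - 1) = A(y) / B(y) multiplied by alpha x. *)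
exists x, y; split=> //; split=> //; exists (x / linq_f q d a y).
rewrite mulf_neq0 ?invr_eq0 //= divfK //; split=> //; split=> //.
rewrite /gbin -(prednK (q_pos k)) exprS Ex.
apply: (mulIf nz_fy); rewrite -[RHS]mulrAC divfK // mulrDl.
have -> : alpha * (x * (A.[y] / B.[y])) * linq_f q d a y = x * A.[y].
  transitivity (x * A.[y] / B.[y] * B.[y]); first by rewrite ByE; ring.
  by rewrite divfK.
by rewrite AyE; ring.
Qed.
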